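(* Let $G$ be a group which is the central product of normal subgroups $H$ and $K$ (so $G=HK$, $[H,K]=1$), with $A=H\cap K$ and $Z=H'\cap K'$, and let $D$ be a divisible abelian group with trivial $G$-action. Let $L$ be the kernel of the inflation map $\operatorname{H}^2(H/A,D)\to\operatorname{H}^2(H/Z,D)$ and $M$ the kernel of the inflation map $\operatorname{H}^2(K/A,D)\to\operatorname{H}^2(K/Z,D)$; then $L\cong\operatorname{Hom}((A\cap H')/Z,D)$ and $M\cong \operatorname{Hom}((A\cap K')/Z,D)$. Then: (i) there is a subgroup $N$ of $\operatorname{H}^2(H/A,D)/L\oplus \operatorname{H}^2(K/A,D)/M$ with $N\cong \operatorname{Hom}(Z,D)$ such that $$\big(\operatorname{H}^2(H/A,D)/L\oplus \operatorname{H}^2(K/A,D)/M\big)/N\;\oplus\;\operatorname{Hom}(H/A\otimes K/A,D)$$ embeds (as a subgroup) in $\operatorname{H}^2(G,D)$; (ii) there is a subgroup $N'$ of $\operatorname{H}^2(H/Z,D)\oplus \operatorname{H}^2(K/Z,D)$ with $N'\cong\operatorname{Hom}(Z,D)$ such that $\operatorname{H}^2(G,D)$ embeds in $$\big(\operatorname{H}^2(H/Z,D)\oplus \operatorname{H}^2(K/Z,D)\big)/N'\;\oplus\;\operatorname{Hom}(H\otimes K,D).$$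
   Context: $X'$ denotes the commutator subgroup of $X$. For groups $X,Y$, $X\otimes Y$ denotes the abelian tensor product $X/X'\otimes_{\mathbb{Z}} Y/Y'$. $\operatorname{H}^2(X,D)$ is the second cohomology group with trivial coefficients $D$; inflation maps are the standard ones induced by quotient maps. *)

(* Defs.v *)
From HB Require Import structures.
From mathcomp Require Import all_boot.
From mathcomp Require Import monoid.
From mathcomp Require Import all_algebra.

Set Implicit Arguments.
Unset Strict Implicit.
Unset Printing Implicit Defensive.

Import GRing.Theory.

Section GroupNotions.
Variable G : groupType.
Local Open Scope group_scope.

Definition is_subgroup (P : G -> Prop) : Prop :=
  P 1 /\ (forall x y, P x -> P y -> P (x * y^-1)).

Definition normal_in (N P : G -> Prop) : Prop :=
  is_subgroup N /\ (forall x, N x -> P x) /\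
  (forall x y, N x -> P y -> N (x ^ y)).

Definition setT_g : G -> Prop := fun _ => True.
Definition set1_g : G -> Prop := fun x => x = 1.
Definition setI_g (P Q : G -> Prop) : G -> Prop := fun x => P x /\ Q x.

Definition gen_g (S : G -> Prop) : G -> Prop :=
  fun x => forall P, is_subgroup P -> (forall y, S y -> P y) -> P x.

Definition derived (P : G -> Prop) : G -> Prop :=
  gen_g (fun z => exists x y, P x /\ P y /\ z = [~ x, y]).

Definition central_product (H K : G -> Prop) : Prop :=
  normal_in H setT_g /\ normal_in K setT_g /\
  (forall g, exists h k, H h /\ K k /\ g = h * k) /\
  (forall h k, H h -> K k -> h * k = k * h).

End GroupNotions.

Definition divisible (D : zmodType) : Prop :=
  forall (d : D) (n : nat), (0 < n)%N -> exists e : D, (e *+ n)%R = d.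

(* Abelian groups presented as subquotients: a carrier with addition,  *)
(* a predicate of admissible representatives and an equality relation  *)
(* (equality of the represented elements).                             *)
Record agrp := AGrp {
  ac : Type;
  aadd : ac -> ac -> ac;
  aopp : ac -> ac;
  azero : ac;
  amem : ac -> Prop;
  aeq : ac -> ac -> Prop }.
Arguments aadd : clear implicits.
Arguments aopp : clear implicits.
Arguments amem : clear implicits.
Arguments aeq : clear implicits.

Definition is_ahom (A B : agrp) (f : ac A -> ac B) : Prop :=
  (forall x, amem A x -> amem B (f x)) /\
  (forall x y, amem A x -> amem A y -> aeq A x y -> aeq B (f x) (f y)) /\
  (forall x y, amem A x -> amem A y ->
     aeq B (f (aadd A x y)) (aadd B (f x) (f y))).

Definition ainjective (A B : agrp) (f : ac A -> ac B) : Prop :=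
  forall x y, amem A x -> amem A y -> aeq B (f x) (f y) -> aeq A x y.

Definition asurjective (A B : agrp) (f : ac A -> ac B) : Prop :=
  forall y, amem B y -> exists x, amem A x /\ aeq B (f x) y.

Definition aiso (A B : agrp) : Prop :=
  exists f : ac A -> ac B, [/\ is_ahom f, ainjective f & asurjective f].

Definition aembeds (A B : agrp) : Prop :=
  exists f : ac A -> ac B, is_ahom f /\ ainjective f.

Definition is_asubgroup (A : agrp) (S : ac A -> Prop) : Prop :=
  [/\ (forall x, S x -> amem A x), S (azero A),
      (forall x y, S x -> S y -> S (aadd A x y)),
      (forall x, S x -> S (aopp A x)) &
      (forall x y, S x -> amem A y -> aeq A x y -> S y)].

Definition asub (A : agrp) (S : ac A -> Prop) : agrp :=
  @AGrp (ac A) (@aadd A) (@aopp A) (azero A) S (@aeq A).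

Definition aquot (A : agrp) (S : ac A -> Prop) : agrp :=
  @AGrp (ac A) (@aadd A) (@aopp A) (azero A) (@amem A)
        (fun x y => S (aadd A x (aopp A y))).

Definition asum (A B : agrp) : agrp :=
  @AGrp (ac A * ac B)%type
    (fun x y => (aadd A x.1 y.1, aadd B x.2 y.2))
    (fun x => (aopp A x.1, aopp B x.2))
    (azero A, azero B)
    (fun x => amem A x.1 /\ amem B x.2)
    (fun x y => aeq A x.1 y.1 /\ aeq B x.2 y.2).

Definition akernel (A B : agrp) (f : ac A -> ac B) : ac A -> Prop :=
  fun x => amem A x /\ aeq B (f x) (azero B).

(* A quotient P/N of a subgroup P of G by N <| P is handled through     *)
(* functions on P that are constant on the cosets of N (i.e. functions  *)
(* on P/N composed with the projection P -> P/N).                       *)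
Section Cohomology.
Variables (G : groupType) (D : zmodType).
Local Open Scope group_scope.

Definition HomQ (P N : G -> Prop) : agrp :=
  @AGrp (G -> D) (fun f g x => (f x + g x)%R) (fun f x => (- f x)%R)
    (fun _ => 0%R)
    (fun phi => (forall x y, P x -> P y -> phi (x * y)%g = (phi x + phi y)%R) /\
                (forall x a, P x -> N a -> phi (x * a)%g = phi x))
    (fun phi psi => forall x, P x -> phi x = psi x).

(* H^2(P/N, D), trivial action: (inhomogeneous, not necessarily normalised) 2-cocycles modulo
   2-coboundaries, with d f (x,y,z) = f(y,z) - f(xy,z) + f(x,yz) - f(x,y)
   and d c (x,y) = c(x) + c(y) - c(xy). *)
Definition H2Q (P N : G -> Prop) : agrp :=
  @AGrp (G -> G -> D) (fun f g x y => (f x y + g x y)%R)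
    (fun f x y => (- f x y)%R) (fun _ _ => 0%R)
    (fun f =>
       (forall x y z, P x -> P y -> P z ->
          (f y z - f (x * y)%g z + f x (y * z)%g - f x y = 0)%R) /\
       (forall x y a b, P x -> P y -> N a -> N b ->
          f (x * a)%g (y * b)%g = f x y))
    (fun f g => exists c : G -> D,
       (forall x a, P x -> N a -> c (x * a)%g = c x) /\
       (forall x y, P x -> P y ->
          (f x y - g x y = c x + c y - c (x * y)%g)%R)).

(* Inflation H^2(P/N, D) -> H^2(P/N', D) for N' <= N: composition with
   the projection P/N' -> P/N, which on our representatives (functions
   on P constant on N-cosets) is the identity. *)
Definition infl (f : G -> G -> D) : G -> G -> D := f.

(* Hom(P1/N1 (x) P2/N2, D), the tensor product being the abelian one
   (X/X' (x)_Z Y/Y'): by the universal property of the tensor product,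
   represented by the biadditive maps (P1/N1)^ab x (P2/N2)^ab -> D, i.e.
   bimultiplicative maps P1 x P2 -> D constant on N1 x N2 cosets. *)
Definition HomTensorQ (P1 N1 P2 N2 : G -> Prop) : agrp :=
  @AGrp (G -> G -> D) (fun f g x y => (f x y + g x y)%R)
    (fun f x y => (- f x y)%R) (fun _ _ => 0%R)
    (fun b =>
       [/\ (forall x x' y, P1 x -> P1 x' -> P2 y ->
              b (x * x')%g y = (b x y + b x' y)%R),
           (forall x y y', P1 x -> P2 y -> P2 y' ->
              b x (y * y')%g = (b x y + b x y')%R) &
           (forall x y a c, P1 x -> P2 y -> N1 a -> N2 c ->
              b (x * a)%g (y * c)%g = b x y)])
    (fun b b' => forall x y, P1 x -> P2 y -> b x y = b' x y).

End Cohomology.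

Arguments asub : clear implicits.
Arguments aquot : clear implicits.
Arguments akernel : clear implicits.
Arguments is_asubgroup : clear implicits.

(* Main.v *)
Require Import Defs.
From HB Require Import structures.
From mathcomp Require Import all_boot.
From mathcomp Require Import monoid.
From mathcomp Require Import all_algebra.
From mathcomp Require Import boolp classical_sets.

(** Write [tra] for the transgression Hom(A, D) -> H^2(P/A, D) of a central
    subgroup [A] of [P]: the kernel of [tra] consists of the characters vanishing
    on [A ∩ P'], since characters of subgroups extend to a divisible group, and
    the kernel of the inflation H^2(P/A, D) -> H^2(P/Z, D) is [tra (Hom(A/Z, D))].

    (i) As G/A = H/A x K/A, inflation from G/A to G is a map from
    H^2(H/A) + H^2(K/A) + Hom(H/A (x) K/A, D) to H^2(G, D).  Its kernel is the set
    of the [(tra chi, tra chi, 0)]; because H' ∩ K' = Z, these are the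
    [(tra chi1, tra chi2, 0)] with [chi1 = chi2] on [Z].

    (ii) The commutator pairing of a central extension of G by D is trivial on
    Z x G, so the preimage of Z is central and splits: every class on G is inflated
    from G/Z.  A class on G/Z is determined by its restrictions to H/Z and K/Z and
    the commutator pairing H x K -> D: two splittings over H/Z and K/Z differ on
    A/Z by a character, which is a sum of characters of H/Z and of K/Z.  The kernel
    of the inflation from G/Z consists of the transgressions of Hom(Z, D). *)

Set Implicit Arguments.
Unset Strict Implicit.
Unset Printing Implicit Defensive.

Import GRing.Theory.

(** * A decision procedure for identities in abelian groups *)

Inductive zexp := ZVar of nat | ZZero | ZAdd of zexp & zexp | ZOpp of zexp.

Fixpoint zeval (D : zmodType) (s : seq D) (e : zexp) : D :=
  match e with
  | ZVar i => nth 0%R s i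
  | ZZero => 0%R
  | ZAdd a b => (zeval s a + zeval s b)%R
  | ZOpp a => (- zeval s a)%R
  end.

(* Positive ([b = true]) and negative occurrences of the variable [i]. *)
Fixpoint zcount (b : bool) (e : zexp) (i : nat) : nat :=
  match e with
  | ZVar j => if b then nat_of_bool (j == i) else 0
  | ZZero => 0
  | ZAdd e1 e2 => zcount b e1 i + zcount b e2 i
  | ZOpp e1 => zcount (~~ b) e1 i
  end.

(** Positive and negative occurrences are counted apart, so that natural-number coefficients
    suffice; a variable beyond the list has the default value 0 and enters neither sum. *)
Lemma zevalE (D : zmodType) (s : seq D) e :
  zeval s e = (\sum_(i < size s) nth 0 s i *+ zcount true e i
               - \sum_(i < size s) nth 0 s i *+ zcount false e i)%R.
Proof.
elim: e => [j||a IHa b IHb|a IHa] /=.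
- rewrite [X in (_ - X)%R]big1 => [|i _]; last by rewrite mulr0n.
  rewrite subr0; case: (ltnP j (size s)) => [ltj|lej].
    rewrite (bigD1 (Ordinal ltj)) //= eqxx mulr1n big1 ?addr0 // => i neq.
    have -> : (j == i) = false.
      by apply/eqP => ji; case/eqP: neq; apply: val_inj.
    by rewrite mulr0n.
  rewrite nth_default // big1 // => i _; rewrite gtn_eqF ?mulr0n //.
  exact: leq_trans (ltn_ord i) lej.
- by rewrite !big1 ?subr0 // => i _; rewrite mulr0n.
- rewrite IHa IHb.
  under [X in _ = (X - _)%R]eq_bigr do rewrite mulrnDr.
  under [X in _ = (_ - X)%R]eq_bigr do rewrite mulrnDr.
  by rewrite !big_split /= opprD addrACA.
- by rewrite IHa opprB.
Qed.

Lemma zeval_eq (D : zmodType) (s : seq D) e1 e2 :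
  all (fun i => zcount true e1 i + zcount false e2 i ==
                zcount true e2 i + zcount false e1 i) (iota 0 (size s)) ->
  zeval s e1 = zeval s e2.
Proof.
move/allP => chk; apply/eqP; rewrite !zevalE subr_eq addrAC eq_sym subr_eq.
rewrite -!big_split; apply/eqP; apply: eq_bigr => i _ /=.
rewrite -!mulrnDr; congr (_ *+ _)%R; apply/esym/eqP/chk.
by rewrite mem_iota /= add0n.
Qed.

(* Atoms are compared up to conversion, as rewriting may change the way in
   which structures are inferred. *)
Ltac zindex x s :=
  match s with
  | ?y :: _ => let e := constr:(erefl x : x = y) in constr:(0)
  | _ :: ?s' => let n := zindex x s' in constr:(S n)
  end.

Ltac zinsert x s :=
  match s with
  | _ => let n := zindex x s in s
  | _ => constr:(x :: s)
  end.

Ltac zatoms t s :=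
  lazymatch t with
  | (?a + ?b)%R => let s1 := zatoms a s in zatoms b s1
  | (- ?a)%R => zatoms a s
  | 0%R => s
  | ?x => zinsert x s
  end.

Ltac zreify t s :=
  lazymatch t with
  | (?a + ?b)%R =>
      let x := zreify a s in let y := zreify b s in constr:(ZAdd x y)
  | (- ?a)%R => let x := zreify a s in constr:(ZOpp x)
  | 0%R => constr:(ZZero)
  | ?x => let n := zindex x s in constr:(ZVar n)
  end.

Ltac zmod :=
  lazymatch goal with
  | |- @eq ?T ?l ?r =>
      let s0 := zatoms l (@nil T) in
      let s := zatoms r s0 in
      let a := zreify l s in
      let b := zreify r s in
      apply: (@zeval_eq _ s a b); vm_compute; reflexivity
  end.

Section LinearCombination.
Variable D : zmodType.
Local Open Scope ring_scope.

(** The pattern for deriving equations: [a = b] combines known equations by [eqD] and [eqB], and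
    [x - y = a - b] is a formal identity left to [zmod]. *)
Lemma eq_lc (x y a b : D) : a = b -> x - y = a - b -> x = y.
Proof. by move=> -> /eqP; rewrite subrr subr_eq0 => /eqP. Qed.

Lemma eqD (a b c d : D) : a = b -> c = d -> a + c = b + d.
Proof. by move=> -> ->. Qed.

Lemma eqB (a b c d : D) : a = b -> c = d -> a - c = b - d.
Proof. by move=> -> ->. Qed.

End LinearCombination.

Local Open Scope group_scope.

(** * Subgroups and homomorphisms *)

Section Subgroups.
Variable G : groupType.
Implicit Types (P Q : G -> Prop) (x y z : G).

Lemma subgroup1 P : is_subgroup P -> P 1. Proof. by case. Qed.

Lemma subgroupV P x : is_subgroup P -> P x -> P x^-1.
Proof. by case=> P1 PB Px; rewrite -div1g; apply: PB. Qed.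

Lemma subgroupM P x y : is_subgroup P -> P x -> P y -> P (x * y).
Proof.
by move=> sP Px Py; rewrite -[y]invgK; apply: sP.2 => //; apply: subgroupV.
Qed.

Lemma subgroupX P x n : is_subgroup P -> P x -> P (x ^+ n).
Proof.
move=> sP Px; elim: n => [|n IHn]; first exact: subgroup1.
by rewrite expgS; apply: subgroupM.
Qed.

Lemma subgroupJ P x y : is_subgroup P -> P x -> P y -> P (x ^ y).
Proof.
by move=> sP Px Py; apply: subgroupM (subgroupV _ _) (subgroupM _ _ _).
Qed.

Lemma subgroupR P x y : is_subgroup P -> P x -> P y -> P [~ x, y].
Proof.
by move=> sP Px Py; apply: subgroupM (subgroupV _ _) (subgroupJ _ _ _).
Qed.

Lemma subgroupI P Q :
  is_subgroup P -> is_subgroup Q -> is_subgroup (setI_g P Q).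
Proof.
move=> sP sQ; split; first by split; apply: subgroup1.
by move=> x y [Px Qx] [Py Qy]; split; [apply: sP.2 | apply: sQ.2].
Qed.

Lemma subgroupT : is_subgroup (@setT_g G). Proof. by []. Qed.

Lemma derived_subgroup P : is_subgroup (derived P).
Proof.
split=> [Q sQ _|x y dx dy Q sQ sub]; first exact: subgroup1.
by apply: sQ.2; [apply: dx | apply: dy].
Qed.

Lemma derivedR P x y : P x -> P y -> derived P [~ x, y].
Proof. by move=> Px Py Q sQ; apply; exists x, y. Qed.

Lemma derived_sub P x : is_subgroup P -> derived P x -> P x.
Proof.
by move=> sP; apply=> // _ [y [z [Py [Pz ->]]]]; apply: subgroupR.
Qed.

Lemma derivedJ P x y : is_subgroup P -> derived P x -> P y -> derived P (x ^ y).
Proof.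
move=> sP dx Py; apply: (dx (fun x => derived P (x ^ y))).
  split=> [|a b da db]; first by rewrite conj1g; case: (derived_subgroup P).
  by rewrite conjMg conjVg; apply: (derived_subgroup P).2.
move=> _ [a [b [Pa [Pb ->]]]]; rewrite conjRg.
by apply: derivedR; apply: subgroupJ.
Qed.

Lemma derived_abelian P x :
  (forall y z, P y -> P z -> y * z = z * y) -> derived P x -> x = 1.
Proof.
move=> cP dx; apply: (dx (@set1_g G)); first by split=> // a b -> ->; rewrite divg1.
by move=> _ [a [b [Pa [Pb ->]]]]; apply/eqP/commgP/cP.
Qed.

(** An adjoined element need not commute with the domain of a partial homomorphism; regrouping costs
    one commutator, which [hom_graph_adjoin] sends to 0. *)
Lemma divg_mulg_comm (x y a b : G) :
  x * y^-1 * (a * b^-1) = x * a * (y * b)^-1 * [~ y^-1, a * b^-1].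
Proof.
by rewrite invgM -[LHS]mulgA (commgC y^-1) -!mulgA.
Qed.

Variable D : zmodType.
Implicit Types phi psi : G -> D.

Definition hom_on P phi :=
  forall x y, P x -> P y -> phi (x * y) = (phi x + phi y)%R.

Lemma hom_on1 P phi : is_subgroup P -> hom_on P phi -> phi 1 = 0%R.
Proof.
move=> sP hphi; apply: (eq_lc (esym (hphi 1 1 sP.1 sP.1))); rewrite mulg1; zmod.
Qed.

Lemma hom_onV P phi x :
  is_subgroup P -> hom_on P phi -> P x -> phi x^-1 = (- phi x)%R.
Proof.
move=> sP hphi Px; have := hphi _ _ Px (subgroupV sP Px).
rewrite mulgV (hom_on1 sP hphi) => E; apply: (eq_lc (esym E)); zmod.
Qed.

Lemma hom_on_derived P phi x :
  is_subgroup P -> hom_on P phi -> derived P x -> phi x = 0%R.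
Proof.
move=> sP hphi dx.
suff [] : P x /\ phi x = 0%R by [].
apply: (dx (fun x => P x /\ phi x = 0%R)).
  split=> [|a b [Pa a0] [Pb b0]].
    by split; [apply: subgroup1 | apply: hom_on1 hphi].
  split; first exact: sP.2.
  by rewrite hphi ?(hom_onV sP) ?a0 ?b0 ?oppr0 ?addr0 //; apply: subgroupV.
move=> _ [a [b [Pa [Pb ->]]]]; split; first exact: subgroupR.
have PVa := subgroupV sP Pa; have PVb := subgroupV sP Pb.
have Pab := subgroupM sP Pa Pb.
rewrite commgEl conjgE !hphi ?(hom_onV sP) //; first zmod.
exact: subgroupM.
Qed.

Lemma hom_on_sub P Q phi :
  (forall x, Q x -> P x) -> hom_on P phi -> hom_on Q phi.
Proof. by move=> sQP hphi x y /sQP Px /sQP Py; apply: hphi. Qed.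

Lemma hom_onD P phi psi :
  hom_on P phi -> hom_on P psi -> hom_on P (fun x => phi x + psi x)%R.
Proof. by move=> h1 h2 x y Px Py; rewrite h1 // h2 //; zmod. Qed.

Lemma hom_onB P phi psi :
  hom_on P phi -> hom_on P psi -> hom_on P (fun x => phi x - psi x)%R.
Proof. by move=> h1 h2 x y Px Py; rewrite h1 // h2 //; zmod. Qed.

End Subgroups.

(** * Extension of homomorphisms into a divisible group *)

Section Extension.
Variables (G : groupType) (D : zmodType) (P : G -> Prop).
Hypotheses (divD : divisible D) (sP : is_subgroup P).

Local Open Scope classical_set_scope.

(** A homomorphism from a subgroup of [P] to [D], given by its graph: a subgroup in which only 0
    lies over 1. Inclusion of graphs is the order for Zorn's lemma. *)
Definition hom_graph (R : set (G * D)) : Prop :=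
  [/\ R (1, 0%R),
      forall u v, R u -> R v -> R (u.1 * v.1^-1, (u.2 - v.2)%R),
      forall u, R u -> P u.1 &
      forall d, R (1, d) -> d = 0%R].

Lemma hom_graph_inj R x d d' :
  hom_graph R -> R (x, d) -> R (x, d') -> d = d'.
Proof.
move=> [_ RB _ R1] xd xd'; have /= := RB _ _ xd xd'; rewrite mulgV => /R1.
by move/eqP; rewrite subr_eq0 => /eqP.
Qed.

Lemma hom_graphV R x d : hom_graph R -> R (x, d) -> R (x^-1, (- d)%R).
Proof.
by move=> [R0 RB _ _] xd; have /= := RB _ _ R0 xd; rewrite div1g sub0r.
Qed.

Lemma hom_graphM R x y d d' :
  hom_graph R -> R (x, d) -> R (y, d') -> R (x * y, (d + d')%R).
Proof.
move=> gR xd /(hom_graphV gR) yd'; have [_ RB _ _] := gR.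
by have /= := RB _ _ xd yd'; rewrite invgK opprK.
Qed.

Lemma hom_graphX R x d n : hom_graph R -> R (x, d) -> R (x ^+ n, (d *+ n)%R).
Proof.
move=> gR xd; elim: n => [|n IHn]; first by case: gR.
by rewrite expgS mulrS; apply: hom_graphM.
Qed.

(** [e] is a possible value at [x]. If a positive power of [x] lies in the domain, all exponents
    that occur are multiples of the least one, and divisibility of [D] lets the value there be
    divided by it; otherwise any [e] works. *)
Lemma hom_graph_root R x : hom_graph R ->
  exists e : D, forall n d, R (x ^+ n, d) -> d = (e *+ n)%R.
Proof.
move=> gR; have [ex|nex] := pselect (exists n, `[< exists d, R (x ^+ n.+1, d) >]).
  case: (ex_minnP ex) => n /asboolP[d nd] minn.
  have [e ed] := divD d (ltn0Sn n); exists e => m d' md'.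
  have qd := hom_graphX (m %/ n.+1) gR nd.
  have [_ RB _ R1] := gR.
  have /= := RB _ _ md' qd; rewrite -expgnA mulnC.
  rewrite -expgnFr ?leq_trunc_div // {1}(divn_eq m n.+1) addKn.
  have := ltn_pmod m (ltn0Sn n); case E : (m %% n.+1) => [|r] ltr.
    move=> /R1 /eqP; rewrite subr_eq0 => /eqP ->.
    by rewrite -ed -mulrnA mulnC [in RHS](divn_eq m n.+1) E addn0.
  (* A nonzero remainder [r.+1] would be a positive exponent below the least one, [n.+1]. *)
  move=> rd; suff : n <= r by rewrite leqNgt -ltnS ltr.
  by apply: minn; apply/asboolP; exists (d' - d *+ (m %/ n.+1))%R.
exists 0%R => -[|n] d nd; first by case: gR => _ _ _ /(_ _ nd).
by case: nex; exists n; apply/asboolP; exists d.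
Qed.

Lemma hom_graph_adjoin R x : hom_graph R -> P x ->
  (forall z, derived P z -> R (z, 0%R)) ->
  exists R', [/\ hom_graph R', R `<=` R' & exists e, R' (x, e)].
Proof.
move=> gR Px dR; have [e eP] := hom_graph_root x gR; have [R0 RB RP R1] := gR.
exists [set u | P u.1 /\ exists n m,
  R (u.1 * (x ^+ n * x ^- m), (u.2 + (e *+ n - e *+ m))%R)].
split; last first.
- exists e; split=> //=; exists 0%N, 1%N; rewrite mul1g mulgV mulr0n sub0r mulr1n.
  by rewrite subrr.
- move=> u Ru; split; first exact: RP.
  by exists 0, 0; rewrite /= invg1 !mulg1 subrr addr0; case: u Ru.
(* Single-valuedness: by the choice of [e], the only value [R] can have at x^(n - m) is (n - m)e. *)
have adj1 n m d : R (x ^+ n * x ^- m, (d + (e *+ n - e *+ m))%R) -> d = 0%R.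
  case: (leqP m n) => [le|/ltnW le] Rd.
    move: Rd; rewrite -expgnFr // => /eP; rewrite mulrnBr // => E.
    by apply: (eq_lc E); zmod.
  move/(hom_graphV gR): Rd; rewrite invgF -expgnFr // => /eP.
  by rewrite mulrnBr // => E; apply: (eq_lc (esym E)); zmod.
split=> /=.
- split; first exact: subgroup1.
  by exists 0, 0; rewrite invg1 !mulg1 subrr addr0.
- move=> [g d] [g' d'] /= [Pg [n [m Rg]]] [Pg' [n' [m' Rg']]].
  split; first exact: sP.2.
  exists (n + m'), (m + n').
  have -> : (d - d' + (e *+ (n + m') - e *+ (m + n')))%R =
            (d + (e *+ n - e *+ m) - (d' + (e *+ n' - e *+ m')) + 0)%R.
    by rewrite !mulrnDr; zmod.
  set p := x ^+ n * x ^- m in Rg; set p' := x ^+ n' * x ^- m' in Rg'.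
  have Pp : P p by apply: sP.2; apply: subgroupX.
  have Pp' : P p' by apply: sP.2; apply: subgroupX.
  have Epp : x ^+ (n + m') * x ^- (m + n') = p * p'^-1.
    rewrite /p /p' invgF (addnC m) !expgnDr invgM -!mulgA; congr (_ * _).
    by rewrite !mulgA; congr (_ * _); apply/commuteV/commuteX2.
  have Ppp : P (p * p'^-1) by apply: sP.2.
  have -> : g * g'^-1 * (x ^+ (n + m') * x ^- (m + n')) =
            g * p * (g' * p')^-1 * [~ g'^-1, p * p'^-1].
    by rewrite Epp divg_mulg_comm.
  have dz : derived P [~ g'^-1, p * p'^-1].
    by apply: derivedR => //; apply: subgroupV.
  have /= Rgg := RB _ _ Rg Rg'.
  exact: hom_graphM gR Rgg (dR _ dz).
- by move=> u [].
- by move=> d [_ [n [m]]]; rewrite mul1g => /adj1.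
Qed.

(** As [phi] vanishes on the part of [Q] in P', it induces a homomorphism on QP' that is trivial on
    P'. A maximal extension of its graph has domain [P], since any missing element can be
    adjoined. *)
Lemma hom_extend (Q : G -> Prop) (phi : G -> D) :
  is_subgroup Q -> (forall x, Q x -> P x) -> hom_on Q phi ->
  (forall x, Q x -> derived P x -> phi x = 0%R) ->
  exists psi, hom_on P psi /\ forall x, Q x -> psi x = phi x.
Proof.
move=> sQ sQP hphi phi0; have sd := derived_subgroup P.
pose R0 : set (G * D) := [set u | exists q z,
  [/\ Q q, derived P z & u = (q * z, phi q)]].
have gR0 : hom_graph R0.
  split.
  - exists 1, 1; split; [exact: subgroup1 | exact: subgroup1 |].
    by rewrite mulg1 (hom_on1 sQ hphi).
  - move=> _ _ [q [z [Qq dz ->]]] [q' [z' [Qq' dz' ->]]] /=.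
    exists (q * q'^-1), ((z * z'^-1) ^ q'^-1); split; first exact: sQ.2.
      by apply: derivedJ => //; [apply: sd.2 | apply: subgroupV => //; apply: sQP].
    rewrite hphi ?(hom_onV sQ) //; last exact: subgroupV.
    by congr (_, _); rewrite -[RHS]mulgA -conjgC invgM !mulgA.
  - move=> _ [q [z [Qq dz ->]]] /=; apply: subgroupM => //; first exact: sQP.
    exact: derived_sub.
  - move=> d [q [z [Qq dz [/esym E ->]]]]; apply: phi0 => //.
    have -> : q = z^-1 by apply/eqP; rewrite -mulg_eq1 E.
    exact: subgroupV sd dz.
have [F FP Ftot|R [gR maxR]] :=
  @Zorn_bigcup _ [set R : set (G * D) | hom_graph (R0 `|` R)].
  (* The chain may be empty; admitting [set0] provides a member in every case. *)
  pose good (X : set (G * D)) := F X \/ X = set0.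
  have goodP X : good X -> hom_graph (R0 `|` X).
    by case=> [/FP //|->]; rewrite setU0.
  have pick u : (R0 `|` \bigcup_(X in F) X) u -> exists X, good X /\ (R0 `|` X) u.
    move=> [R0u|[X FX Xu]]; first by exists set0; split; [right | left].
    by exists X; split; [left | right].
  have sub X u : good X -> (R0 `|` X) u -> (R0 `|` \bigcup_(X in F) X) u.
    by move=> [FX|->] [R0u|Xu] //; [left | right; exists X | left].
  have pick2 u v : (R0 `|` \bigcup_(X in F) X) u ->
      (R0 `|` \bigcup_(X in F) X) v ->
      exists X, [/\ good X, (R0 `|` X) u & (R0 `|` X) v].
    move=> /pick[X [gX Xu]] /pick[Y [gY Yv]].
    have [XY|YX] : X `<=` Y \/ Y `<=` X.
      case: gX gY => [FX|->] [FY|->]; first exact: Ftot.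
      - by right.
      - by left.
      - by left.
    - by exists Y; split=> //; case: Xu; [left | right; apply: XY].
    - by exists X; split=> //; case: Yv; [left | right; apply: YX].
  split.
  - by left; case: gR0.
  - move=> u v /pick2 /[apply] -[X [gX Xu Xv]]; apply: (sub X) => //.
    by case: (goodP _ gX) => _ + _ _; apply.
  - by move=> u /pick[X [gX Xu]]; case: (goodP _ gX) => _ _ + _; apply.
  - by move=> d /pick[X [gX Xu]]; case: (goodP _ gX) => _ _ _; apply.
have tot x : P x -> exists d, (R0 `|` R) (x, d).
  move=> Px; apply: contrapT => nx.
  have dR z : derived P z -> (R0 `|` R) (z, 0%R).
    move=> dz; left; exists 1, z; split=> //; first exact: subgroup1.
    by rewrite mul1g (hom_on1 sQ hphi).
  have [R' [gR' RR' [e xe]]] := hom_graph_adjoin gR Px dR.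
  apply: (maxR R').
    split=> [u Ru|R'R]; first by apply: RR'; right.
    by apply: nx; exists e; right; apply: R'R.
  suff RE : R0 `|` R' = R' by rewrite /= RE.
  by apply/setUidPr => u R0u; apply: RR'; left.
have [psi psiP] : {psi & forall x, P x -> (R0 `|` R) (x, psi x)}.
  apply: (@choice _ _ (fun x d => P x -> (R0 `|` R) (x, d))) => x.
  have [Px|nPx] := pselect (P x); last by exists 0%R.
  by have [d] := tot x Px; exists d.
exists psi; split=> [x y Px Py|x Qx].
  apply: (hom_graph_inj gR (psiP _ (subgroupM sP Px Py))).
  exact: hom_graphM gR (psiP _ Px) (psiP _ Py).
apply: (hom_graph_inj gR (psiP _ (sQP _ Qx))); left.
by exists x, 1; rewrite mulg1; split=> //; apply: subgroup1.
Qed.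

End Extension.

(** * Subquotients *)

Section Subquotients.
Variables (A B : agrp) (r : ac A -> ac B -> Prop).
Hypotheses
  (A_refl : forall x, amem A x -> aeq A x x)
  (A_add : forall x y, amem A x -> amem A y -> amem A (aadd A x y))
  (r_total : forall x, amem A x -> exists u, amem B u /\ r x u)
  (r_add : forall x y u v, amem A x -> amem A y ->
     r x u -> r y v -> r (aadd A x y) (aadd B u v))
  (r_eq : forall x y u v, amem A x -> amem A y ->
     r x u -> r y v -> aeq A x y <-> aeq B u v).

(** A map of subquotients may be given as a relation on representatives: choice selects a function,
    one direction of [r_eq] makes it well defined and the other injective. *)
Let rfun : exists f : ac A -> ac B,
  [/\ is_ahom f, ainjective f & forall x, amem A x -> r x (f x)].
Proof.
have [f fP] : {f & forall x, amem A x -> amem B (f x) /\ r x (f x)}.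
  apply: (@choice _ _ (fun x u => amem A x -> amem B u /\ r x u)) => x.
  have [mx|nmx] := pselect (amem A x); last by exists (azero B).
  by have [u] := r_total mx; exists u.
exists f; split.
- split=> [x /fP[]//|]; split=> [x y mx my|x y mx my].
    by case: (r_eq mx my (fP _ mx).2 (fP _ my).2).
  have mxy := A_add mx my.
  have rD := r_add mx my (fP _ mx).2 (fP _ my).2.
  by case: (r_eq mxy mxy (fP _ mxy).2 rD) => + _; apply; apply: A_refl.
- by move=> x y mx my; case: (r_eq mx my (fP _ mx).2 (fP _ my).2).
- by move=> x /fP[].
Qed.

Lemma aembeds_rel : aembeds A B.
Proof. by have [f [hf fi _]] := rfun; exists f. Qed.

Lemma aiso_rel :
  (forall u, amem B u -> exists2 x, amem A x & r x u) -> aiso A B.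
Proof.
move=> r_surj; have [f [hf fi fP]] := rfun; exists f; split=> // u mu.
have [x mx rxu] := r_surj _ mu; exists x; split=> //.
by case: (r_eq mx mx (fP _ mx) rxu) => + _; apply; apply: A_refl.
Qed.

End Subquotients.

(** * Cocycles and transgression *)

Section Cocycles.
Variables (G : groupType) (D : zmodType).
Implicit Types (P A Z : G -> Prop) (x y : G) (f : G -> G -> D) (c chi : G -> D).
Local Open Scope ring_scope.

Definition central_in A P :=
  forall a x, A a -> P x -> (a * x = x * a)%g.

Definition cocycle_on P f := forall x y z, P x -> P y -> P z ->
  f y z - f (x * y)%g z + f x (y * z)%g - f x y = 0.

Definition cobounds P c f := forall x y, P x -> P y ->
  f x y = c x + c y - c (x * y)%g.

Definition twisted P A chi c := forall x a, P x -> A a ->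
  c (x * a)%g = c x + chi a.

(* [f] represents the image of [chi] under Hom(A, D) -> H^2(P/A, D), the
   transgression of the central extension A -> P -> P/A. *)
Definition transgresses P A chi f := exists2 c, twisted P A chi c & cobounds P c f.

Lemma cocycle_l1 P f x :
  is_subgroup P -> cocycle_on P f -> P x -> f 1%g x = f 1%g 1%g.
Proof.
move=> sP cf Px; have := cf _ _ _ sP.1 sP.1 Px.
by rewrite !mul1g => E; apply: (eq_lc E); zmod.
Qed.

Lemma cocycle_r1 P f x :
  is_subgroup P -> cocycle_on P f -> P x -> f x 1%g = f 1%g 1%g.
Proof.
move=> sP cf Px; have := cf _ _ _ Px sP.1 sP.1.
by rewrite !mulg1 => E; apply: (eq_lc (esym E)); zmod.
Qed.

Lemma cocycleD P f g : cocycle_on P f -> cocycle_on P g ->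
  cocycle_on P (fun x y => f x y + g x y).
Proof.
move=> cf cg x y z Px Py Pz; have E := cf _ _ _ Px Py Pz.
have E' := cg _ _ _ Px Py Pz; apply: (eq_lc (eqD E E')); zmod.
Qed.

Lemma cocycleB P f g : cocycle_on P f -> cocycle_on P g ->
  cocycle_on P (fun x y => f x y - g x y).
Proof.
move=> cf cg x y z Px Py Pz; have E := cf _ _ _ Px Py Pz.
have E' := cg _ _ _ Px Py Pz; apply: (eq_lc (eqB E E')); zmod.
Qed.

Lemma cobounds_cocycle P c f : is_subgroup P -> cobounds P c f -> cocycle_on P f.
Proof.
move=> sP cf x y z Px Py Pz.
have Pxy := subgroupM sP Px Py; have Pyz := subgroupM sP Py Pz.
by rewrite !cf // mulgA; zmod.
Qed.

Lemma cobounds1 P c f : is_subgroup P -> cobounds P c f -> c 1%g = f 1%g 1%g.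
Proof. by move=> sP cf; rewrite cf ?mulg1; [zmod | case: sP | case: sP]. Qed.

(* In the central extension defined by [f], commutation with a lift of [x] is a
   homomorphism on the centraliser of [x]. *)
Lemma cocycle_commM P f x y z :
  is_subgroup P -> cocycle_on P f -> P x -> P y -> P z ->
  (x * y = y * x)%g -> (x * z = z * x)%g ->
  f x (y * z)%g - f (y * z)%g x = (f x y - f y x) + (f x z - f z x).
Proof.
move=> sP cf Px Py Pz cxy cxz.
have := cf _ _ _ Py Px Pz; have := cf _ _ _ Py Pz Px; have := cf _ _ _ Px Py Pz.
by rewrite cxy cxz => E1 E2 E3; apply: (eq_lc (eqB (eqD E1 E2) E3)); zmod.
Qed.

(** The lifts of [k] and [h'] to the extension commute, so the product of the lifts of [h], [k],
    [h'], [k'] can be regrouped; this amounts to four instances of the cocycle identity. *)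
Lemma cocycle_interchange P f h k h' k' :
  is_subgroup P -> cocycle_on P f -> P h -> P k -> P h' -> P k' ->
  (k * h' = h' * k)%g -> f k h' = f h' k ->
  f (h * k)%g (h' * k')%g + f h k + f h' k' =
  f h h' + f k k' + f (h * h')%g (k * k')%g.
Proof.
move=> sP cf Ph Pk Ph' Pk' ckh fkh.
have := cf _ _ _ Ph Pk (subgroupM sP Ph' Pk').
have := cf _ _ _ Pk Ph' Pk'; have := cf _ _ _ Ph' Pk Pk'.
have := cf _ _ _ Ph Ph' (subgroupM sP Pk Pk').
rewrite ckh fkh !mulgA ckh => E1 E2 E3 E4.
apply: (eq_lc (eqD (eqB E1 E4) (eqB E3 E2))); zmod.
Qed.

Lemma transversal A : is_subgroup A -> exists r : G -> G,
  (forall x, A ((r x)^-1 * x)%g) /\ (forall x a, A a -> r (x * a)%g = r x).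
Proof.
move=> sA; exists (fun x => xget 1%g [set y | A (y^-1 * x)%g]).
split=> [x|x a Aa].
  by case: xgetP => [y _ //|/(_ x)[]] /=; rewrite mulVg; apply: subgroup1.
(* The two sets of candidates are equal, so [xget] picks the same representative. *)
congr xget; apply/predeqP => y /=; rewrite mulgA; split=> [Axa|Ax].
  by rewrite -[(y^-1 * x)%g](mulgK a); apply: sA.2.
exact: subgroupM.
Qed.

Lemma twisted_ex A chi : is_subgroup A -> hom_on A chi ->
  exists c, twisted (@setT_g G) A chi c.
Proof.
move=> sA hchi; have [r [rP rM]] := transversal sA.
exists (fun x => chi ((r x)^-1 * x)%g) => x a _ Aa.
by rewrite rM // mulgA hchi.
Qed.

Lemma twisted_hom P A chi c : is_subgroup P -> is_subgroup A ->
  (forall x, A x -> P x) -> twisted P A chi c -> hom_on A chi.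
Proof.
move=> sP sA AP tc x y Ax Ay.
have P1 := subgroup1 sP; have P1x := subgroupM sP P1 (AP _ Ax).
have := tc _ _ P1 (subgroupM sA Ax Ay); rewrite mulgA !tc //.
by move=> E; apply: (eq_lc (esym E)); zmod.
Qed.

Lemma transgressesD P A chi chi' f f' :
  transgresses P A chi f -> transgresses P A chi' f' ->
  transgresses P A (fun x => chi x + chi' x) (fun x y => f x y + f' x y).
Proof.
move=> [c tc cf] [c' tc' cf']; exists (fun x => c x + c' x) => x y Px Py.
  by rewrite tc // tc' //; zmod.
by rewrite cf // cf' //; zmod.
Qed.

Lemma transgressesB P A chi chi' f f' :
  transgresses P A chi f -> transgresses P A chi' f' ->
  transgresses P A (fun x => chi x - chi' x) (fun x y => f x y - f' x y).
Proof.
move=> [c tc cf] [c' tc' cf']; exists (fun x => c x - c' x) => x y Px Py.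
  by rewrite tc // tc' //; zmod.
by rewrite cf // cf' //; zmod.
Qed.

Lemma transgressesN P A chi f : transgresses P A chi f ->
  transgresses P A (fun x => - chi x) (fun x y => - f x y).
Proof.
move=> [c tc cf]; exists (fun x => - c x) => x y Px Py.
  by rewrite tc //; zmod.
by rewrite cf //; zmod.
Qed.

Lemma transgresses0 P A : transgresses P A (fun _ => 0) (fun _ _ => 0).
Proof. by exists (fun _ => 0) => x y _ _; zmod. Qed.

Lemma H2Q_refl P A f : aeq (H2Q D P A) f f.
Proof. by exists (fun _ => 0); split=> [//|x y _ _]; zmod. Qed.

Lemma H2Q_sym P A f g : aeq (H2Q D P A) f g -> aeq (H2Q D P A) g f.
Proof.
move=> [c [ic cf]]; exists (fun x => - c x).
split=> [x a Px Aa|x y Px Py]; first by rewrite ic.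
by apply: (eq_lc (esym (cf _ _ Px Py))); zmod.
Qed.

Lemma H2Q_trans P A f g h : aeq (H2Q D P A) f g -> aeq (H2Q D P A) g h ->
  aeq (H2Q D P A) f h.
Proof.
move=> [c [ic cf]] [c' [ic' cg]]; exists (fun x => c x + c' x).
split=> [x a Px Aa|x y Px Py]; first by rewrite ic // ic'.
by apply: (eq_lc (eqD (cf _ _ Px Py) (cg _ _ Px Py))); zmod.
Qed.

Lemma H2Q_memD P A f g : amem (H2Q D P A) f -> amem (H2Q D P A) g ->
  amem (H2Q D P A) (fun x y => f x y + g x y).
Proof.
move=> [cf jf] [cg jg]; split; first exact: cocycleD.
by move=> x y a b Px Py Aa Ab; rewrite jf // jg.
Qed.

Lemma H2Q_memB P A f g : amem (H2Q D P A) f -> amem (H2Q D P A) g ->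
  amem (H2Q D P A) (fun x y => f x y - g x y).
Proof.
move=> [cf jf] [cg jg]; split; first exact: cocycleB.
by move=> x y a b Px Py Aa Ab; rewrite jf // jg.
Qed.

Lemma HomTensorQ_memD P1 N1 P2 N2 (b b' : G -> G -> D) :
  amem (HomTensorQ D P1 N1 P2 N2) b -> amem (HomTensorQ D P1 N1 P2 N2) b' ->
  amem (HomTensorQ D P1 N1 P2 N2) (fun x y => b x y + b' x y).
Proof.
move=> [bl br bi] [bl' br' bi'].
split=> [x x' y Px Px' Py|x y y' Px Py Py'|x y a c Px Py Na Nc].
- by rewrite bl // bl' //; zmod.
- by rewrite br // br' //; zmod.
- by rewrite bi // bi'.
Qed.

Lemma HomTensorQ_memB P1 N1 P2 N2 (b b' : G -> G -> D) :
  amem (HomTensorQ D P1 N1 P2 N2) b -> amem (HomTensorQ D P1 N1 P2 N2) b' ->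
  amem (HomTensorQ D P1 N1 P2 N2) (fun x y => b x y - b' x y).
Proof.
move=> [bl br bi] [bl' br' bi'].
split=> [x x' y Px Px' Py|x y y' Px Py Py'|x y a c Px Py Na Nc].
- by rewrite bl // bl' //; zmod.
- by rewrite br // br' //; zmod.
- by rewrite bi // bi'.
Qed.

(** * Transgression of characters of a central subgroup *)

Section Central.
Variables P A : G -> Prop.
Hypotheses (sP : is_subgroup P) (sA : is_subgroup A).
Hypotheses (AP : forall x, A x -> P x) (cA : central_in A P).

Lemma transgresses_hom chi f : transgresses P A chi f -> hom_on A chi.
Proof. by move=> [c tc _]; apply: twisted_hom tc. Qed.

Lemma transgresses_mem chi f :
  transgresses P A chi f -> amem (H2Q D P A) f.
Proof.
move=> [c tc cf]; split; first exact: cobounds_cocycle cf.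
move=> x y a b Px Py Aa Ab.
have Pxa := subgroupM sP Px (AP Aa); have Pyb := subgroupM sP Py (AP Ab).
have Pxy := subgroupM sP Px Py.
have Pxya := subgroupM sP Pxy (AP Aa).
have E : (x * a * (y * b) = x * y * a * b)%g.
  by rewrite !mulgA -(mulgA x a y) (cA Aa Py) mulgA.
rewrite !cf // E (tc x a) // (tc y b) // (tc _ b) // (tc _ a) //; zmod.
Qed.

Lemma transgresses_ex chi : hom_on A chi -> exists f, transgresses P A chi f.
Proof.
move=> hchi; have [c tc] := twisted_ex sA hchi.
by exists (fun x y => c x + c y - c (x * y)%g), c => // x a _; apply: tc.
Qed.

Lemma transgresses_aeq chi f f' : transgresses P A chi f ->
  aeq (H2Q D P A) f f' -> transgresses P A chi f'.
Proof.
move=> [c tc cf] [e [ie ef]]; exists (fun x => c x - e x) => x y Px Py.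
  by rewrite tc // ie //; zmod.
by apply: (eq_lc (eqB (cf _ _ Px Py) (ef _ _ Px Py))); zmod.
Qed.

(** Invariance of [f] gives [f x a = f 1 1 = c 1], so [c] changes by [c a - c 1] along a coset; the
    constant appears because cocycles are not normalised. *)
Lemma cobounds_transgresses c f : amem (H2Q D P A) f -> cobounds P c f ->
  transgresses P A (fun a => c a - c 1%g) f.
Proof.
move=> [cf jf] df; exists c => // x a Px Aa; have Pa := AP Aa.
have := jf x 1%g 1%g a Px sP.1 sA.1 Aa; rewrite mul1g mulg1.
rewrite (cocycle_r1 sP cf Px) -(cobounds1 sP df) df // => E.
by apply: (eq_lc (esym E)); zmod.
Qed.

(** Corrected by an invariant cochain, the twisted cochain becomes a homomorphism on [P]; it kills
    P' and restricts to [chi] on [A]. *)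
Lemma transgresses_aeq0 chi f x : transgresses P A chi f ->
  aeq (H2Q D P A) f (fun _ _ => 0) -> A x -> derived P x -> chi x = 0.
Proof.
move=> tf f0 Ax dx; have [c tc cf] := transgresses_aeq tf f0.
have hc : hom_on P c.
  by move=> y z Py Pz; apply: (eq_lc (cf _ _ Py Pz)); zmod.
have := tc _ _ sP.1 Ax; rewrite mul1g (hom_on_derived sP hc dx) (hom_on1 sP hc).
by move=> E; apply: (eq_lc (esym E)); zmod.
Qed.

Lemma transgresses_inj chi chi' f f' x :
  transgresses P A chi f -> transgresses P A chi' f' ->
  aeq (H2Q D P A) f f' -> A x -> derived P x -> chi x = chi' x.
Proof.
move=> tf tf' ff' Ax dx.
have := transgresses_aeq0 (transgressesB (transgresses_aeq tf ff') tf') _ Ax dx.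
move=> E; apply: (eq_lc (E _)); last by zmod.
by exists (fun _ => 0); split=> [//|y z _ _]; zmod.
Qed.

Hypothesis divD : divisible D.

(** The difference of the characters extends to a homomorphism of [P], whose coboundary is 0;
    subtracting it from the cochain changes the character and keeps [f]. *)
Lemma transgresses_change chi chi' f :
  transgresses P A chi f -> hom_on A chi' ->
  (forall x, A x -> derived P x -> chi x = chi' x) ->
  transgresses P A chi' f.
Proof.
move=> tf hchi' eqchi; have hchi := transgresses_hom tf.
have [|psi [hpsi psiE]] := hom_extend divD sP sA AP (hom_onB hchi hchi').
  by move=> x Ax dx; rewrite eqchi // subrr.
have [c tc cf] := tf; exists (fun x => c x - psi x) => [x a Px Aa|x y Px Py].
  by have Pa := AP Aa; rewrite tc // hpsi // (psiE a) //; zmod.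
by rewrite cf // hpsi //; zmod.
Qed.

Lemma transgresses_eq chi chi' f f' :
  transgresses P A chi f -> transgresses P A chi' f' ->
  (forall x, A x -> derived P x -> chi x = chi' x) -> aeq (H2Q D P A) f f'.
Proof.
move=> tf tf' eqchi.
have [c tc cf] := transgresses_change tf (transgresses_hom tf') eqchi.
have [c' tc' cf'] := tf'; exists (fun x => c x - c' x).
split=> [x a Px Aa|x y Px Py]; first by rewrite tc // tc' //; zmod.
by rewrite cf // cf' //; zmod.
Qed.

(** A twisted cochain is constant on the cosets of [Z] exactly when its character vanishes on
    [Z]. *)
Lemma ker_inflP Z f : is_subgroup Z -> (forall x, Z x -> A x) ->
  akernel (H2Q D P A) (H2Q D P Z) (@infl G D) f <->
  exists2 chi, transgresses P A chi f & forall x, Z x -> chi x = 0.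
Proof.
move=> sZ ZA; split=> [[mf [c [ic cf]]]|[chi tf chi0]].
  exists (fun a => c a - c 1%g).
    apply: cobounds_transgresses => // x y Px Py.
    by rewrite -cf // /infl subr0.
  by move=> z Zz; rewrite -[z]mul1g ic ?subrr //; case: sP.
split; first exact: transgresses_mem tf.
have [c tc cf] := tf; exists c.
split=> [x z Px Zz|x y Px Py]; last by rewrite /infl cf // subr0.
by rewrite tc ?chi0 ?addr0 //; apply: ZA.
Qed.

Lemma ker_infl_iso Z : is_subgroup Z ->
  (forall x, Z x -> A x) -> (forall x, Z x -> derived P x) ->
  aiso (asub (H2Q D P A) (akernel (H2Q D P A) (H2Q D P Z) (@infl G D)))
       (HomQ D (setI_g A (derived P)) Z).
Proof.
move=> sZ ZA ZP; have sd := derived_subgroup P.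
set L := asub _ _; set Hom := HomQ _ _ _.
apply: (@aiso_rel L Hom (fun f phi => exists chi,
  [/\ transgresses P A chi f, forall x, Z x -> chi x = 0 &
      forall x, A x -> derived P x -> phi x = chi x])); rewrite {}/L {}/Hom /=.
- by move=> f _; apply: H2Q_refl.
- move=> f g /ker_inflP -/(_ sZ ZA)[chi tf chi0].
  move=> /ker_inflP -/(_ sZ ZA)[chi' tg chi0'].
  apply/ker_inflP => //; exists (fun x => chi x + chi' x).
    exact: transgressesD.
  by move=> x Zx; rewrite chi0 // chi0' // addr0.
- move=> f /ker_inflP -/(_ sZ ZA)[chi tf chi0]; have hchi := transgresses_hom tf.
  exists chi; split; last by exists chi.
  split=> [x y [Ax _] [Ay _]|x a [Ax _] Za]; first exact: hchi.
  by rewrite hchi ?(chi0 a) ?addr0 //; apply: ZA.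
- move=> f g phi psi _ _ [chi [tf chi0 phiE]] [chi' [tg chi0' psiE]].
  exists (fun x => chi x + chi' x); split; first exact: transgressesD.
    by move=> x Zx; rewrite chi0 // chi0' // addr0.
  by move=> x Ax dx; rewrite phiE // psiE.
- move=> f g phi psi _ _ [chi [tf chi0 phiE]] [chi' [tg chi0' psiE]].
  split=> [fg x [Ax dx]|E].
    by rewrite phiE // psiE //; apply: transgresses_inj tf tg fg Ax dx.
  by apply: transgresses_eq tf tg _ => x Ax dx; rewrite -phiE // -psiE //; apply: E.
- move=> phi [hphi iphi].
  have sI : is_subgroup (setI_g A (derived P)) := subgroupI sA sd.
  have [x []//|//|x Ix dAx|psi [hpsi psiE]] := hom_extend divD sA (phi := phi) sI.
    rewrite (derived_abelian _ dAx); first exact: hom_on1 sI hphi.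
    by move=> y z Ay /AP; apply: cA.
  have [f tf] := transgresses_ex hpsi.
  have psi0 x : Z x -> psi x = 0.
    move=> Zx; have Ix := conj (ZA _ Zx) (ZP _ Zx).
    by rewrite psiE // -[x]mul1g iphi ?(hom_on1 sI hphi) //; apply: subgroup1.
  exists f; first by apply/ker_inflP => //; exists psi.
  by exists psi; split=> // x Ax dx; rewrite psiE.
Qed.

End Central.
End Cocycles.

(** * Central extensions *)

Section CentralExtension.
Variables (G : groupType) (D : zmodType) (f : G -> G -> D).
Local Open Scope ring_scope.

Definition ext_group (cf : cocycle_on (@setT_g G) f) : Type := (D * G)%type.

Hypothesis cf : cocycle_on (@setT_g G) f.
Local Notation E := (ext_group cf).

HB.instance Definition _ := Choice.on E.

Let cfE x y z : f y z - f (x * y)%g z + f x (y * z)%g - f x y = 0.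
Proof. exact: cf. Qed.

Definition ext_mul (u v : E) : E := (u.1 + v.1 + f u.2 v.2, (u.2 * v.2)%g).
(** The cocycle is not normalised: [D] sits in the extension as the pairs (d - f(1,1), 1), whence
    the constants here and in the inverse. *)
Definition ext_one : E := (- f 1%g 1%g, 1%g).
Definition ext_inv (u : E) : E :=
  (- u.1 - f u.2 u.2^-1%g - f 1%g 1%g, u.2^-1%g).

Lemma ext_mulA : associative ext_mul.
Proof.
move=> [d x] [e y] [d' z]; rewrite /ext_mul /= mulgA; congr (_, _).
by apply: (eq_lc (cfE x y z)); zmod.
Qed.

Lemma ext_mul1 : left_id ext_one ext_mul.
Proof.
move=> [d x]; rewrite /ext_mul /= mul1g (cocycle_l1 (subgroupT G) cf) //.
by congr (_, _); zmod.
Qed.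

Lemma ext_1mul : right_id ext_one ext_mul.
Proof.
move=> [d x]; rewrite /ext_mul /= mulg1 (cocycle_r1 (subgroupT G) cf) //.
by congr (_, _); zmod.
Qed.

Lemma ext_mulV : right_inverse ext_one ext_inv ext_mul.
Proof.
by move=> [d x]; rewrite /ext_mul /= mulgV; congr (_, _) => /=; zmod.
Qed.

Lemma ext_Vmul : left_inverse ext_one ext_inv ext_mul.
Proof.
move=> [d x]; rewrite /ext_mul /= mulVg; congr (_, _) => /=.
have := cfE x x^-1%g x; rewrite mulVg mulgV (cocycle_l1 (subgroupT G) cf) //.
rewrite (cocycle_r1 (subgroupT G) cf) // => e.
by apply: (eq_lc e); zmod.
Qed.

HB.instance Definition _ :=
  isGroup.Build E ext_mulA ext_mul1 ext_1mul ext_Vmul ext_mulV.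

Hypothesis divD : divisible D.

(* A retraction onto [D] of the preimage of [Z] in the extension splits it. *)
Lemma symmetric_cocycle_cobounds (Z : G -> Prop) : is_subgroup Z ->
  (forall x y, Z x -> Z y -> (x * y = y * x)%g) ->
  (forall x y, Z x -> Z y -> f x y = f y x) ->
  exists t, cobounds Z t f.
Proof.
move=> sZ cZ fC.
pose P (u : E) := Z u.2; pose Q (u : E) := u.2 = 1%g.
pose phi (u : E) : D := u.1 + f 1%g 1%g.
have sP : is_subgroup P.
  by split=> [|u v Pu Pv]; [case: sZ | apply: sZ.2].
have sQ : is_subgroup Q.
  by split=> [//|u v Qu Qv]; rewrite /Q /= Qu Qv mulgV.
have QP u : Q u -> P u by move=> Qu; rewrite /P Qu; case: sZ.
have hphi : hom_on Q phi.
  by move=> u v Qu Qv; rewrite /phi /= Qu Qv; zmod.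
have [|psi [hpsi psiE]] := hom_extend divD sP sQ QP hphi.
  (* The preimage [P] of [Z] is abelian because [f] is symmetric on [Z], so P' obstructs nothing. *)
  move=> u Qu dPu; have -> : u = 1%g.
    apply: (derived_abelian _ dPu) => -[d x] [e y] Zx Zy.
    by congr (_, _) => /=; [rewrite (fC _ _ Zx Zy); zmod | apply: cZ].
  by rewrite /phi /=; zmod.
pose sec x : E := (0, x).
exists (fun x => psi (sec x)) => x y Zx Zy.
have Zxy := subgroupM sZ Zx Zy.
rewrite -hpsi //.
have -> : (sec x * sec y = ((f x y - f 1%g 1%g, 1%g) : E) * sec (x * y))%g.
  congr (_, _) => /=; last by rewrite mul1g.
  by rewrite (cocycle_l1 (subgroupT G) cf) //; zmod.
rewrite hpsi //; last exact: QP.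
by rewrite psiE // /phi /=; zmod.
Qed.

(** The extension splits over [Z]; choosing lifts along each coset of [Z] compatibly with the
    splitting makes the cocycle constant on cosets. *)
Lemma central_invariant_rep (Z : G -> Prop) : is_subgroup Z ->
  central_in Z (@setT_g G) -> (forall z x, Z z -> f z x = f x z) ->
  exists f', amem (H2Q D (@setT_g G) Z) f' /\
             aeq (H2Q D (@setT_g G) (@set1_g G)) f f'.
Proof.
move=> sZ cZ fC.
have [t tf] : exists t, cobounds Z t f.
  by apply: symmetric_cocycle_cobounds => // x y Zx Zy; [apply: cZ | apply: fC].
have [r [rP rM]] := transversal sZ.
(* This cochain replaces the lift of [x] by the lift of [r x] times the split lift of the remaining
   factor in [Z]. *)
pose c x := t ((r x)^-1 * x)%g - f (r x) ((r x)^-1 * x)%g.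
have cM x z : Z z -> c (x * z)%g = c x + t z - f x z.
  move=> Zz; rewrite /c rM // mulgA.
  have := cfE (r x) ((r x)^-1 * x)%g z; rewrite mulVKg => e.
  by apply: (eq_lc (eqB (tf _ _ (rP x) Zz) e)); zmod.
exists (fun x y => f x y - (c x + c y - c (x * y)%g)); split.
  split=> [x y z _ _ _|x y a b _ _ Za Zb].
    by apply: (eq_lc (cfE x y z)); rewrite mulgA; zmod.
  have e : (x * a * (y * b) = x * y * (a * b))%g.
    by rewrite !mulgA -(mulgA x a y) (cZ _ _ Za) // mulgA.
  have Zab := subgroupM sZ Za Zb.
  have e' := cocycle_interchange (h := x) (h' := y) (k' := b)
    (subgroupT G) cf I I I I (cZ _ _ Za I) (fC _ _ Za).
  rewrite e (cM x a) // (cM y b) // (cM _ (a * b)%g) //.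
  by apply: (eq_lc (eqD e' (tf _ _ Za Zb))); zmod.
exists c; split=> [x _ _ ->|x y _ _]; first by rewrite mulg1.
by zmod.
Qed.

End CentralExtension.

(** * Central products *)

Section CentralProduct.
Variables (G : groupType) (D : zmodType) (H K : G -> Prop).
Hypotheses (HK : central_product H K) (divD : divisible D).
Local Open Scope ring_scope.

Local Notation A := (setI_g H K).
Local Notation Z := (setI_g (derived H) (derived K)).
Local Notation H2G := (H2Q D (@setT_g G) (@set1_g G)).

Let sH : is_subgroup H. Proof. by case: HK => -[]. Qed.
Let sK : is_subgroup K. Proof. by case: HK => _ [[]]. Qed.
Let cHK h k : H h -> K k -> (h * k = k * h)%g.
Proof. by case: HK => _ [_ [_]]; apply. Qed.
Let sA : is_subgroup A. Proof. exact: subgroupI. Qed.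
Let sZ : is_subgroup Z. Proof. by apply: subgroupI; apply: derived_subgroup. Qed.
Let AH x : A x -> H x. Proof. by case. Qed.
Let AK x : A x -> K x. Proof. by case. Qed.
Let cAH : central_in A H. Proof. by move=> a h [_ Ka] Hh; apply/esym/cHK. Qed.
Let cAK : central_in A K. Proof. by move=> a k [Ha _] Kk; apply: cHK. Qed.
Let ZA x : Z x -> A x.
Proof. by move=> [dHx dKx]; split; apply: derived_sub. Qed.
Let ZH x : Z x -> H x. Proof. by move/ZA/AH. Qed.
Let ZK x : Z x -> K x. Proof. by move/ZA/AK. Qed.
Let cZH : central_in Z H. Proof. by move=> z h /ZA; apply: cAH. Qed.
Let cZK : central_in Z K. Proof. by move=> z k /ZA; apply: cAK. Qed.

Lemma decomposition : exists eta kap : G -> G,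
  [/\ forall g, H (eta g), forall g, K (kap g) &
      forall g, (eta g * kap g = g)%g].
Proof.
have [dec decP] : {dec : G -> G * G & forall g,
    [/\ H (dec g).1, K (dec g).2 & g = ((dec g).1 * (dec g).2)%g]}.
  apply: (@choice _ _ (fun g d => [/\ H d.1, K d.2 & g = (d.1 * d.2)%g])) => g.
  case: HK => _ [_ [/(_ g)[h [k [Hh [Kk ->]]]] _]].
  by exists (h, k).
exists (fun g => (dec g).1), (fun g => (dec g).2).
by split=> g; case: (decP g).
Qed.

Lemma decomposition_uniq h k h' k' : H h -> K k -> H h' -> K k' ->
  (h * k = h' * k')%g ->
  exists2 a, A a & h' = (h * a)%g /\ k' = (k * a^-1)%g.
Proof.
move=> Hh Kk Hh' Kk' E; have Ea : (h^-1 * h' = k * k'^-1)%g.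
  by apply: (mulgI h); apply: (mulIg k'); rewrite mulVKg mulgA mulgVK.
have Aa : A (h^-1 * h')%g.
  by split; [apply: subgroupM => //; apply: subgroupV | rewrite Ea; apply: sK.2].
exists (h^-1 * h')%g => //; split; first by rewrite mulVKg.
have AVa := subgroupV sA Aa.
by rewrite -(cAK AVa) // Ea invgF mulgVK.
Qed.

(* A homomorphism on [A ∩ K'] vanishing on [Z] extends to [H] because
   [(A ∩ K') ∩ H' = Z]. *)
Lemma hom_vanish_interpolate (chi : G -> D) : hom_on A chi ->
  (forall z, Z z -> chi z = 0) ->
  exists2 psi, hom_on H psi & forall x, A x -> derived K x -> psi x = chi x.
Proof.
move=> hchi chi0.
have sI : is_subgroup (setI_g A (derived K)).
  by apply: subgroupI sA (derived_subgroup K).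
have [x [/AH //]|x y [Ax _] [Ay _]|x [_ dKx] dHx|psi [hpsi psiE]] :=
  hom_extend divD sH (phi := chi) sI.
- exact: hchi.
- by apply: chi0.
by exists psi => // x Ax dx; apply: psiE.
Qed.

(** [chi1] is corrected by a homomorphism of [H] that equals [chi2 - chi1] on the part of [A] in K';
    it is trivial on H', so the values of [chi1] there survive. *)
Lemma hom_glue (chi1 chi2 : G -> D) : hom_on A chi1 -> hom_on A chi2 ->
  (forall z, Z z -> chi1 z = chi2 z) ->
  exists chi, [/\ hom_on A chi,
    forall x, A x -> derived H x -> chi1 x = chi x &
    forall x, A x -> derived K x -> chi2 x = chi x].
Proof.
move=> h1 h2 E.
have [z Zz|psi hpsi psiE] := hom_vanish_interpolate (hom_onB h2 h1).
  by rewrite E // subrr.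
exists (fun x => chi1 x + psi x); split.
- by apply: hom_onD => //; apply: hom_on_sub hpsi.
- by move=> x _ dx; rewrite (hom_on_derived sH hpsi dx) addr0.
- by move=> x Ax dx; rewrite psiE //; zmod.
Qed.

(** * Classes on G assembled from the two factors *)

Section Product.
Variables eta kap : G -> G.
Hypotheses (etaH : forall g, H (eta g)) (kapK : forall g, K (kap g)).
Hypothesis eta_kap : forall g, (eta g * kap g = g)%g.

Lemma decompositionM g g' : exists2 a, A a &
  eta (g * g')%g = (eta g * eta g' * a)%g /\
  kap (g * g')%g = (kap g * kap g' * a^-1)%g.
Proof.
apply: decomposition_uniq => //; [exact: subgroupM | exact: subgroupM |].
rewrite eta_kap mulgA -(mulgA (eta g)) (cHK (etaH g') (kapK g)).
by rewrite -!mulgA eta_kap mulgA eta_kap.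
Qed.

Lemma decompositionH h : H h -> exists2 a, A a & eta h = (h * a)%g /\ kap h = a^-1%g.
Proof.
move=> Hh; have [|||||a Aa [-> ->]] := @decomposition_uniq h 1%g (eta h) (kap h).
- by []. - exact: sK.1. - by []. - by []. - by rewrite mulg1 eta_kap.
by exists a => //; rewrite mul1g.
Qed.

Lemma decompositionK k : K k -> exists2 a, A a & eta k = a /\ kap k = (k * a^-1)%g.
Proof.
move=> Kk; have [|||||a Aa [-> ->]] := @decomposition_uniq 1%g k (eta k) (kap k).
- exact: sH.1. - by []. - by []. - by []. - by rewrite mul1g eta_kap.
by exists a => //; rewrite mul1g.
Qed.

(* The cross product isomorphism H^2(H/A) + H^2(K/A) + Hom(H/A (x) K/A) ->
   H^2(G/A), for G/A = H/A x K/A, followed by inflation to [G]. *)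
Definition cross (f1 f2 b : G -> G -> D) : G -> G -> D := fun g g' =>
  f1 (eta g) (eta g') + f2 (kap g) (kap g') + b (eta g) (kap g').

Variables f1 f2 b : G -> G -> D.
Hypotheses (mf1 : amem (H2Q D H A) f1) (mf2 : amem (H2Q D K A) f2).
Hypothesis mb : amem (HomTensorQ D H A K A) b.

Let f1l x y a : H x -> H y -> A a -> f1 (x * a)%g y = f1 x y.
Proof.
by move=> Hx Hy Aa; have := mf1.2 x y a 1%g Hx Hy Aa sA.1; rewrite mulg1.
Qed.
Let f1r x y a : H x -> H y -> A a -> f1 x (y * a)%g = f1 x y.
Proof.
by move=> Hx Hy Aa; have := mf1.2 x y 1%g a Hx Hy sA.1 Aa; rewrite mulg1.
Qed.
Let f2l x y a : K x -> K y -> A a -> f2 (x * a)%g y = f2 x y.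
Proof.
by move=> Hx Hy Aa; have := mf2.2 x y a 1%g Hx Hy Aa sA.1; rewrite mulg1.
Qed.
Let f2r x y a : K x -> K y -> A a -> f2 x (y * a)%g = f2 x y.
Proof.
by move=> Hx Hy Aa; have := mf2.2 x y 1%g a Hx Hy sA.1 Aa; rewrite mulg1.
Qed.
Let bl x y a : H x -> K y -> A a -> b (x * a)%g y = b x y.
Proof.
by case: mb => _ _ ib Hx Ky Aa; have := ib x y a 1%g Hx Ky Aa sA.1; rewrite mulg1.
Qed.
Let br x y a : H x -> K y -> A a -> b x (y * a)%g = b x y.
Proof.
by case: mb => _ _ ib Hx Ky Aa; have := ib x y 1%g a Hx Ky sA.1 Aa; rewrite mulg1.
Qed.

Let f1A x a : H x -> A a -> f1 x a = f1 1%g 1%g /\ f1 a x = f1 1%g 1%g.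
Proof.
move=> Hx Aa; have H1 := subgroup1 sH.
split; rewrite -[a]mul1g ?f1r ?f1l //; first exact: cocycle_r1 mf1.1 Hx.
exact: cocycle_l1 mf1.1 Hx.
Qed.
Let f2A x a : K x -> A a -> f2 x a = f2 1%g 1%g /\ f2 a x = f2 1%g 1%g.
Proof.
move=> Kx Aa; have K1 := subgroup1 sK.
split; rewrite -[a]mul1g ?f2r ?f2l //; first exact: cocycle_r1 mf2.1 Kx.
exact: cocycle_l1 mf2.1 Kx.
Qed.
Let bAr x a : H x -> A a -> b x a = 0.
Proof.
move=> Hx Aa; have K1 := subgroup1 sK; rewrite -[a]mul1g br //.
case: mb => _ bM' _; apply: (eq_lc (esym (bM' x _ _ Hx K1 K1))).
by rewrite mulg1; zmod.
Qed.
Let bAl x a : K x -> A a -> b a x = 0.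
Proof.
move=> Kx Aa; have H1 := subgroup1 sH; rewrite -[a]mul1g bl //.
case: mb => bM _ _; apply: (eq_lc (esym (bM _ _ x H1 H1 Kx))).
by rewrite mulg1; zmod.
Qed.

Lemma cross_mem : amem H2G (cross f1 f2 b).
Proof.
split=> [x y z _ _ _|x y _ _ _ _ -> ->]; last by rewrite !mulg1.
rewrite /cross.
have [a Aa [-> ->]] := decompositionM x y.
have [a' Aa' [-> ->]] := decompositionM y z.
have VAa := subgroupV sA Aa; have VAa' := subgroupV sA Aa'.
have Hxy := subgroupM sH (etaH x) (etaH y).
have Hyz := subgroupM sH (etaH y) (etaH z).
have Kxy := subgroupM sK (kapK x) (kapK y).
have Kyz := subgroupM sK (kapK y) (kapK z).
rewrite f1l // f1r // f2l // f2r // bl // br //.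
have E1 := mf1.1 _ _ _ (etaH x) (etaH y) (etaH z).
have E2 := mf2.1 _ _ _ (kapK x) (kapK y) (kapK z).
case: mb => bM bM' _; rewrite bM // bM' //.
by apply: (eq_lc (eqD E1 E2)); zmod.
Qed.

(** Restricting a trivialising cochain to [H] and [K] yields the two transgressions. Conversely the
    characters are glued to a single one on [A], which makes the trivialisations over the two
    factors compatible. *)
Lemma cross_coboundary :
  aeq H2G (cross f1 f2 b) (fun _ _ => 0) <->
  (exists chi1 chi2, [/\ transgresses H A chi1 f1, transgresses K A chi2 f2 &
     forall z, Z z -> chi1 z = chi2 z]) /\
  (forall h k, H h -> K k -> b h k = 0).
Proof.
have H1 := subgroup1 sH; have K1 := subgroup1 sK.
split=> [[c [_ cf]]|[[chi1 [chi2 [t1 t2 E]]] b0]].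
  have cfE x y : cross f1 f2 b x y = c x + c y - c (x * y)%g.
    by rewrite -cf // subr0.
  have crossHH h h' : H h -> H h' -> cross f1 f2 b h h' = f1 h h' + f2 1%g 1%g.
    move=> Hh Hh'; rewrite /cross.
    have [a Aa [-> ->]] := decompositionH Hh.
    have [a' Aa' [-> ->]] := decompositionH Hh'.
    have VAa := subgroupV sA Aa; have VAa' := subgroupV sA Aa'.
    have Hha := subgroupM sH Hh (AH Aa).
    have Hha' := subgroupM sH Hh' (AH Aa').
    by rewrite f1l // f1r // (f2A (AK VAa) VAa').1 (bAr Hha VAa') addr0.
  have crossKK k k' : K k -> K k' -> cross f1 f2 b k k' = f1 1%g 1%g + f2 k k'.
    move=> Kk Kk'; rewrite /cross.
    have [a Aa [-> ->]] := decompositionK Kk.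
    have [a' Aa' [-> ->]] := decompositionK Kk'.
    have VAa := subgroupV sA Aa; have VAa' := subgroupV sA Aa'.
    have Kka := subgroupM sK Kk (AK VAa).
    have Kka' := subgroupM sK Kk' (AK VAa').
    by rewrite f2l // f2r // (f1A (AH Aa) Aa').1 (bAl Kka' Aa) addr0.
  (* A coboundary is symmetric on commuting pairs, so antisymmetrising isolates [b]. *)
  have crossHK h k : H h -> K k ->
      cross f1 f2 b h k - cross f1 f2 b k h = b h k.
    move=> Hh Kk; rewrite /cross.
    have [a Aa [-> ->]] := decompositionH Hh.
    have [a' Aa' [-> ->]] := decompositionK Kk.
    have VAa := subgroupV sA Aa; have VAa' := subgroupV sA Aa'.
    have Hha := subgroupM sH Hh (AH Aa).
    have Kka := subgroupM sK Kk (AK VAa').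
    rewrite (f1A Hha Aa').1 (f1A Hha Aa').2 (f2A Kka VAa).1 (f2A Kka VAa).2.
    by rewrite (bAl (AK VAa) Aa') bl // br //; zmod.
  split; last first.
    move=> h k Hh Kk; rewrite -crossHK // !cfE (cHK Hh Kk); zmod.
  (* Both characters come from the same cochain [c], so they agree on all of [A]. *)
  exists (fun a => c a - c 1%g), (fun a => c a - c 1%g); split=> //.
    have := @cobounds_transgresses _ _ H A sH sA AH (fun x => c x - f2 1%g 1%g) f1 mf1.
    case=> [x y Hx Hy|d td cd].
      by have := crossHH _ _ Hx Hy; rewrite cfE => E; apply: (eq_lc (esym E)); zmod.
    by exists d => // x a Hx Aa; rewrite td //; zmod.
  have := @cobounds_transgresses _ _ K A sK sA AK (fun x => c x - f1 1%g 1%g) f2 mf2.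
  case=> [x y Hx Hy|d td cd].
    by have := crossKK _ _ Hx Hy; rewrite cfE => E; apply: (eq_lc (esym E)); zmod.
  by exists d => // x a Hx Aa; rewrite td //; zmod.
have [chi [hchi E1 E2]] :=
  hom_glue (transgresses_hom sH sA AH t1) (transgresses_hom sK sA AK t2) E.
have [c1 tc1 cf1] := transgresses_change sH sA AH divD t1 hchi E1.
have [c2 tc2 cf2] := transgresses_change sK sA AK divD t2 hchi E2.
(* On a product [eta] is off by [a] and [kap] by [a^-1]; the terms [chi a] and [- chi a] cancel. *)
exists (fun g => c1 (eta g) + c2 (kap g)).
split=> [x _ _ ->|x y _ _]; first by rewrite mulg1.
rewrite /cross b0 // cf1 // cf2 //.
have [a Aa [-> ->]] := decompositionM x y; have VAa := subgroupV sA Aa.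
have Hxy := subgroupM sH (etaH x) (etaH y).
have Kxy := subgroupM sK (kapK x) (kapK y).
by rewrite (tc1 _ a) // (tc2 _ (a^-1)%g) // (hom_onV sA hchi) //; zmod.
Qed.

End Product.

Let hom_extendA (phi : G -> D) : hom_on Z phi ->
  exists2 psi, hom_on A psi & forall x, Z x -> psi x = phi x.
Proof.
move=> hphi; have [x Zx dx|psi [hpsi psiE]] := hom_extend divD sA sZ ZA hphi.
  rewrite (derived_abelian _ dx); first exact: hom_on1 sZ hphi.
  by move=> y a Ay [Ha _]; apply: cAH.
by exists psi.
Qed.

(** * Part (i): classes inflated from G/A *)

Section LowerBound.
Local Notation L := (akernel (H2Q D H A) (H2Q D H Z) (@infl G D)).
Local Notation M := (akernel (H2Q D K A) (H2Q D K Z) (@infl G D)).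
Local Notation S := (asum (aquot (H2Q D H A) L) (aquot (H2Q D K A) M)).

Let inL (f : G -> G -> D) := ker_inflP sH sA AH cAH f sZ ZA.
Let inM (f : G -> G -> D) := ker_inflP sK sA AK cAK f sZ ZA.

(** [N] will consist of the pairs of transgressions whose characters agree on [Z], with [phi] the
    common restriction. The values of the characters off [Z] are absorbed by the quotients by [L]
    and [M]. *)
Let rel (u : ac S) (phi : G -> D) := exists chi1 chi2,
  [/\ transgresses H A chi1 u.1, transgresses K A chi2 u.2,
      forall z, Z z -> chi1 z = phi z & forall z, Z z -> chi2 z = phi z].

Let relB u v phi psi : rel u phi -> rel v psi ->
  rel (aadd S u (aopp S v)) (fun x => phi x - psi x).
Proof.
move=> [c1 [c2 [t1 t2 E1 E2]]] [d1 [d2 [s1 s2 F1 F2]]].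
exists (fun x => c1 x - d1 x), (fun x => c2 x - d2 x).
split; [exact: transgressesB | exact: transgressesB | |] => z Zz.
  by rewrite E1 // F1.
by rewrite E2 // F2.
Qed.

Let relD u v phi psi : rel u phi -> rel v psi ->
  rel (aadd S u v) (fun x => phi x + psi x).
Proof.
move=> [c1 [c2 [t1 t2 E1 E2]]] [d1 [d2 [s1 s2 F1 F2]]].
exists (fun x => c1 x + d1 x), (fun x => c2 x + d2 x).
split; [exact: transgressesD | exact: transgressesD | |] => z Zz.
  by rewrite E1 // F1.
by rewrite E2 // F2.
Qed.

Let rel_mem u phi : rel u phi -> amem S u.
Proof.
move=> [c1 [c2 [t1 t2 _ _]]].
by split; [apply: transgresses_mem t1 | apply: transgresses_mem t2].
Qed.

Let rel_eq u v phi psi : rel u phi -> rel v psi ->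
  aeq S u v <-> forall z, Z z -> phi z = psi z.
Proof.
move=> ru rv; have [c1 [c2 [t1 t2 E1 E2]]] := relB ru rv; split.
  move=> [/inL[chi tchi chi0] _] z Zz; have [dHz _] := Zz.
  have e := transgresses_inj sH tchi t1 (H2Q_refl _ _ _) (ZA Zz) dHz.
  by apply: (eq_lc (esym (E1 _ Zz))); rewrite -e chi0 //; zmod.
move=> E; split; [apply/inL; exists c1 | apply/inM; exists c2] => // z Zz.
  by rewrite E1 // E // subrr.
by rewrite E2 // E // subrr.
Qed.

Lemma H2_central_product_lower : exists N : ac S -> Prop,
  [/\ is_asubgroup S N, aiso (asub S N) (HomQ D Z (@set1_g G)) &
      aembeds (asum (aquot S N) (HomTensorQ D H A K A)) H2G].
Proof.
exists (fun u => exists phi, rel u phi); split.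
- split.
  + by move=> u [phi /rel_mem].
  + exists (fun _ => 0), (fun _ => 0), (fun _ => 0).
    by split=> //; apply: transgresses0.
  + by move=> u v [phi ru] [psi rv]; eexists; apply: relD ru rv.
  + move=> u [phi [c1 [c2 [t1 t2 E1 E2]]]].
    exists (fun x => - phi x), (fun x => - c1 x), (fun x => - c2 x).
    by split=> [||z Zz|z Zz]; [exact: transgressesN | exact: transgressesN
      | rewrite E1 | rewrite E2].
  (* The difference u - v lies in the sum of [L] and [M], so it is related to the zero character,
     and v is recovered as u - (u - v). *)
  + move=> u v [phi ru] mv [/inL[c1 t1 E1] /inM[c2 t2 E2]].
    have rd : rel (aadd S u (aopp S v)) (fun _ => 0) by exists c1, c2.
    have [d1 [d2 [s1 s2 F1 F2]]] := relB ru rd.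
    exists (fun x => phi x - 0), d1, d2; split=> //.
      apply: transgresses_aeq s1 _; exists (fun _ => 0).
      by split=> // x y _ _ /=; zmod.
    apply: transgresses_aeq s2 _; exists (fun _ => 0).
    by split=> // x y _ _ /=; zmod.
- set N := asub _ _; set Hom := HomQ _ _ _.
  apply: (@aiso_rel N Hom rel); rewrite {}/N {}/Hom.
  + by move=> u [phi ru]; apply/(rel_eq ru ru).
  + by move=> u v [phi ru] [psi rv]; eexists; apply: relD ru rv.
  + move=> u [phi ru]; exists phi; split=> //.
    have [c1 [c2 [t1 _ E1 _]]] := ru; have hc1 := transgresses_hom sH sA AH t1.
    split=> [x y Zx Zy|x _ _ ->]; last by rewrite mulg1.
    by rewrite -!E1 ?hc1 //; [apply: ZA | apply: ZA | apply: subgroupM].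
  + by move=> u v phi psi _ _; apply: relD.
  + by move=> u v phi psi _ _; apply: rel_eq.
  + move=> phi [hphi _]; have [psi hpsi psiE] := hom_extendA hphi.
    have [f1 t1] := transgresses_ex H sA hpsi.
    have [f2 t2] := transgresses_ex K sA hpsi.
    have ru : rel (f1, f2) phi by exists psi, psi.
    by exists (f1, f2) => //; exists phi.
- have [eta [kap [etaH kapK eta_kap]]] := decomposition.
  set Src := asum _ _.
  apply: (@aembeds_rel Src H2G (fun x F => forall g g',
    F g g' = cross eta kap x.1.1 x.1.2 x.2 g g')); rewrite {}/Src.
  + move=> [[f1 f2] b] _; split=> //=; exists (fun _ => 0), (fun _ => 0), (fun _ => 0).
    by split=> //; exists (fun _ => 0) => x y _ _ /=; zmod.
  + move=> [[f1 f2] b] [[g1 g2] b'] [[m1 m2] mb] [[n1 n2] nb].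
    by split; [split; exact: H2Q_memD | exact: HomTensorQ_memD].
  + move=> [[f1 f2] b] [[m1 m2] mb]; exists (cross eta kap f1 f2 b).
    by split=> //; apply: cross_mem.
  + move=> [[f1 f2] b] [[g1 g2] b'] F F' _ _ EF EF' g g' /=.
    by rewrite EF EF' /cross /=; zmod.
  + move=> [[f1 f2] b] [[g1 g2] b'] F F' [[m1 m2] mb] [[n1 n2] nb] EF EF'.
    (* [cross] is additive, so comparing two classes reduces to the coboundary criterion for the
       difference. *)
    pose d1 x y := f1 x y - g1 x y; pose d2 x y := f2 x y - g2 x y.
    pose db x y := b x y - b' x y.
    have md1 : amem (H2Q D H A) d1 by apply: H2Q_memB.
    have md2 : amem (H2Q D K A) d2 by apply: H2Q_memB.
    have mdb : amem (HomTensorQ D H A K A) db by apply: HomTensorQ_memB.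
    have dE x y : F x y - F' x y - 0 = cross eta kap d1 d2 db x y - 0.
      by rewrite EF EF' /cross /d1 /d2 /db /=; zmod.
    have dF : aeq H2G F F' <-> aeq H2G (cross eta kap d1 d2 db) (fun _ _ => 0).
      split=> -[c [ic cf]]; exists c; split=> // x y _ _.
        by rewrite -dE subr0 cf.
      by rewrite -[LHS]subr0 dE cf.
    have cobE := cross_coboundary etaH kapK eta_kap md1 md2 mdb.
    split=> [[[phi [c1 [c2 [t1 t2 E1 E2]]]] bE]|/dF/cobE[[c1 [c2 [t1 t2 E]]] b0]].
      apply/dF/cobE; split; last first.
        by move=> h k Hh Kk; rewrite /db; have /= -> := bE h k Hh Kk; rewrite subrr.
      by exists c1, c2; split=> // z Zz; rewrite E1 // E2.
    split; first by exists c2, c1, c2.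
    by move=> h k Hh Kk; apply: subr0_eq; apply: b0.
Qed.

End LowerBound.

(** * Part (ii): restriction of classes on G/Z to the factors *)

Section UpperBound.
Local Notation H2GZ := (H2Q D (@setT_g G) Z).
Local Notation S' := (asum (H2Q D H Z) (H2Q D K Z)).

Let H2GZ_sub P (u : G -> G -> D) : amem H2GZ u -> amem (H2Q D P Z) u.
Proof. by move=> [cu ju]; split=> *; [apply: cu | apply: ju]. Qed.

(* [y |-> f x y - f y x] is a homomorphism on the centraliser of [x], hence it
   vanishes on [K'] for [x] in [H] and on [H'] for [x] in [K]. *)
Lemma cocycle_symmetric_Z (f : G -> G -> D) z g :
  cocycle_on (@setT_g G) f -> Z z -> f z g = f g z.
Proof.
move=> cf Zz; have [dHz dKz] := Zz; have sT := subgroupT G.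
have [eta [kap [etaH kapK eta_kap]]] := decomposition.
have hom x P : (forall y, P y -> (x * y = y * x)%g) ->
    hom_on P (fun y => f x y - f y x).
  by move=> cx y y' /cx cy /cx cy'; apply: cocycle_commM cf _ _ _ cy cy'.
have EH := hom_on_derived sK (hom (eta g) K (fun k => cHK (etaH g))) dKz.
have EK := hom_on_derived sH (hom (kap g) H (fun h Hh => esym (cHK Hh (kapK g)))) dHz.
have Ez := cocycle_commM (x := z) sT cf I I I (cZH Zz (etaH g)) (cZK Zz (kapK g)).
by rewrite eta_kap in Ez; apply: (eq_lc (eqB (eqB Ez EH) EK)); zmod.
Qed.

(** For the converse, the trivialisations over [H] and [K] are twisted by the same [chi], so on [A]
    they differ by a character trivial on [Z]; once it is removed they glue to a cochain on [G]. *)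
Lemma restriction_coboundary (u : G -> G -> D) : amem H2GZ u ->
  aeq H2G u (fun _ _ => 0) <->
  (exists2 chi, transgresses H Z chi u & transgresses K Z chi u) /\
  (forall h k, H h -> K k -> u h k = u k h).
Proof.
move=> mu; split=> [[c [_ cu]]|[[chi tH tK] uC]].
  have {}cu x y : u x y = c x + c y - c (x * y)%g by rewrite -cu // subr0.
  have cuP P : cobounds P c u by move=> x y _ _; apply: cu.
  split; last by move=> h k Hh Kk; rewrite !cu (cHK Hh Kk); zmod.
  exists (fun a => c a - c 1%g).
    exact: (cobounds_transgresses sH sZ ZH (H2GZ_sub H mu) (cuP H)).
  exact: (cobounds_transgresses sK sZ ZK (H2GZ_sub K mu) (cuP K)).
have sT := subgroupT G; have cu : cocycle_on (@setT_g G) u := mu.1.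
have [c1 tc1 cu1] := tH; have [c2 tc2 cu2] := tK.
pose psi x := c1 x - c2 x.
have hpsi : hom_on A psi.
  move=> x y [Hx Kx] [Hy Ky].
  by apply: (eq_lc (eqB (cu1 _ _ Hx Hy) (cu2 _ _ Kx Ky))); rewrite /psi; zmod.
have psi0 z : Z z -> psi z = 0.
  move=> Zz; have e1 := tc1 _ _ sH.1 Zz; have e2 := tc2 _ _ sK.1 Zz.
  rewrite mul1g (cobounds1 sH cu1) in e1; rewrite mul1g (cobounds1 sK cu2) in e2.
  by rewrite /psi e1 e2 subrr.
(* [psi] is a difference of restrictions of homomorphisms [lam] on [H] and [mu']
   on [K], so the two trivialisations can be made to agree on [A]. *)
have [lam hlam lamE] := hom_vanish_interpolate hpsi psi0.
have hlamA : hom_on A lam by apply: hom_on_sub hlam.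
have [x Ax dx|mu' [hmu' mu'E]] := hom_extend divD sK sA AK (hom_onB hlamA hpsi).
  by rewrite lamE // subrr.
pose d1 x := c1 x - lam x; pose d2 x := c2 x - mu' x.
have ud1 : cobounds H d1 u.
  by move=> x y Hx Hy; rewrite cu1 // /d1 hlam //; zmod.
have ud2 : cobounds K d2 u.
  by move=> x y Kx Ky; rewrite cu2 // /d2 hmu' //; zmod.
have dA a : A a -> d1 a = d2 a.
  by move=> Aa; rewrite /d1 /d2 mu'E // /psi; zmod.
have [eta [kap [etaH kapK eta_kap]]] := decomposition.
(* A cochain extending [d1] and [d2] with coboundary [u] must take this value at [h * k]; [eA] makes
   it independent of the decomposition. *)
pose e h k := d1 h + d2 k - u h k.
have eA h k a : H h -> K k -> A a -> e (h * a)%g (k * a^-1)%g = e h k.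
  move=> Hh Kk Aa; have VAa := subgroupV sA Aa.
  rewrite -(cAK VAa Kk) /e.
  have E1 := ud1 _ _ Hh (AH Aa); have E2 := ud2 _ _ (AK VAa) Kk.
  have E3 := ud2 _ _ (AK Aa) (AK VAa); rewrite mulgV (cobounds1 sK ud2) in E3.
  have E4 := cu h a (a^-1 * k)%g I I I; rewrite mulVKg in E4.
  have E5 := cu a a^-1%g k I I I.
  rewrite mulgV (cocycle_l1 sT cu I) in E5.
  have E6 := dA _ Aa.
  apply: (eq_lc (eqD (eqD (eqD (eqD E1 E2) (eqB E4 E5)) E6) (esym E3))); zmod.
exists (fun g => e (eta g) (kap g)).
split=> [x _ _ ->|x y _ _]; first by rewrite mulg1.
have [a Aa [-> ->]] := decompositionM etaH kapK eta_kap x y.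
have Hxy := subgroupM sH (etaH x) (etaH y).
have Kxy := subgroupM sK (kapK x) (kapK y).
rewrite eA // /e.
have E := cocycle_interchange sT cu (I : setT_g (eta x)) (I : setT_g (kap x))
  (I : setT_g (eta y)) (I : setT_g (kap y)) (esym (cHK (etaH y) (kapK x)))
  (esym (uC _ _ (etaH y) (kapK x))).
rewrite !eta_kap in E.
have E1 := ud1 _ _ (etaH x) (etaH y); have E2 := ud2 _ _ (kapK x) (kapK y).
by apply: (eq_lc (eqD E (eqD E1 E2))); zmod.
Qed.

Let rel (u : ac S') (phi : G -> D) :=
  transgresses H Z phi u.1 /\ transgresses K Z phi u.2.

(** A character of [Z] is recovered from its transgression because [Z] lies in H'. *)
Let rel_eq u v phi psi : rel u phi -> rel v psi ->
  aeq S' u v <-> forall z, Z z -> phi z = psi z.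
Proof.
move=> [t1 t2] [s1 s2]; split.
  move=> [E _] z Zz; have [dHz _] := Zz.
  by have := transgresses_inj sH t1 s1 E Zz dHz.
move=> E; split.
  by apply: transgresses_eq t1 s1 _ => // x Zx _; apply: E.
by apply: transgresses_eq t2 s2 _ => // x Zx _; apply: E.
Qed.

Let relD u v phi psi : rel u phi -> rel v psi ->
  rel (aadd S' u v) (fun x => phi x + psi x).
Proof. by move=> [t1 t2] [s1 s2]; split; apply: transgressesD. Qed.

Lemma H2_central_product_upper : exists N' : ac S' -> Prop,
  [/\ is_asubgroup S' N', aiso (asub S' N') (HomQ D Z (@set1_g G)) &
      aembeds H2G
        (asum (aquot S' N') (HomTensorQ D H (@set1_g G) K (@set1_g G)))].
Proof.
have sT := subgroupT G.
exists (fun u => exists phi, rel u phi); split.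
- split.
  + move=> u [phi [t1 t2]].
    by split; [apply: transgresses_mem t1 | apply: transgresses_mem t2].
  + by exists (fun _ => 0); split; apply: transgresses0.
  + by move=> u v [phi ru] [psi rv]; eexists; apply: relD ru rv.
  + move=> u [phi [t1 t2]]; exists (fun x => - phi x).
    by split; apply: transgressesN.
  + move=> u v [phi [t1 t2]] _ [E1 E2]; exists phi.
    by split; [apply: transgresses_aeq t1 E1 | apply: transgresses_aeq t2 E2].
- set N := asub _ _; set Hom := HomQ _ _ _.
  apply: (@aiso_rel N Hom rel); rewrite {}/N {}/Hom.
  + by move=> u [phi ru]; apply/(rel_eq ru ru).
  + by move=> u v [phi ru] [psi rv]; eexists; apply: relD ru rv.
  + move=> u [phi ru]; exists phi; split=> //; have [t1 _] := ru.
    split=> [|x _ _ ->]; last by rewrite mulg1.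
    by have := transgresses_hom sH sZ ZH t1.
  + by move=> u v phi psi _ _; apply: relD.
  + by move=> u v phi psi _ _; apply: rel_eq.
  + move=> phi [hphi _].
    have [f1 t1] := transgresses_ex H sZ hphi.
    have [f2 t2] := transgresses_ex K sZ hphi.
    by exists (f1, f2); [exists phi | ].
- set Dst := asum _ _.
  (* A class goes to the restrictions of a representative [f'] inflated from G/Z and to its
     commutator pairing. The choice of [f'] is free up to a transgression from [Z], which accounts
     for the quotient by [N']. *)
  apply: (@aembeds_rel H2G Dst (fun f x => exists f',
    [/\ amem H2GZ f', aeq H2G f f', x.1 = (f', f') &
        forall h k, H h -> K k -> x.2 h k = f h k - f k h])); rewrite {}/Dst.
  + by move=> f _; apply: H2Q_refl.
  + exact: H2Q_memD.
  + move=> f [cf _].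
    have [|z x Zz|f' [mf' ff']] := central_invariant_rep cf divD sZ.
    * move=> z g Zz _; have [eta [kap [etaH kapK eta_kap]]] := decomposition.
      rewrite -(eta_kap g); apply: commuteM; first exact: cZH.
      exact: cZK.
    * exact: cocycle_symmetric_Z.
    exists ((f', f'), fun h k => f h k - f k h); split; last by exists f'.
    split; first by split; apply: H2GZ_sub.
    split=> /= [x x' y Hx Hx' Ky|x y y' Hx Ky Ky'|x y _ _ _ _ -> ->].
    * have cy := esym (cHK Hx Ky); have cy' := esym (cHK Hx' Ky).
      have E := cocycle_commM sT cf I I I cy cy'.
      by apply: (eq_lc (esym E)); zmod.
    * exact: cocycle_commM cf I I I (cHK Hx Ky) (cHK Hx Ky').
    * by rewrite !mulg1.
  + move=> f g [u b] [v b'] _ _ [f' [mf' ff' /= -> bE]] [g' [mg' gg' /= -> bE']].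
    exists (fun x y => f' x y + g' x y); split=> //=.
    * exact: H2Q_memD.
    * have [c [_ ec]] := ff'; have [c' [_ ec']] := gg'.
      exists (fun x => c x + c' x).
      split=> [x _ _ ->|x y _ _]; first by rewrite mulg1.
      by apply: (eq_lc (eqD (ec x y I I) (ec' x y I I))); zmod.
    * by move=> h k Hh Kk; rewrite bE // bE' //; zmod.
  + move=> f g [u b] [v b'] _ _ [f' [mf' ff' /= -> bE]] [g' [mg' gg' /= -> bE']].
    pose w x y := f' x y - g' x y.
    have mw : amem H2GZ w by apply: H2Q_memB.
    have fgw : aeq H2G f g <-> aeq H2G w (fun _ _ => 0).
      have wE : aeq H2G f' g' <-> aeq H2G w (fun _ _ => 0).
        split=> -[c [ic ec]]; exists c; split=> // x y _ _; rewrite -ec //.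
          by rewrite /w subr0.
        by rewrite /w subr0.
      split=> [E|/wE E]; last exact: H2Q_trans ff' (H2Q_trans E (H2Q_sym gg')).
      by apply/wE; apply: H2Q_trans (H2Q_sym ff') (H2Q_trans E gg').
    (* Coboundaries are symmetric on commuting pairs, so [f'] and [f] have the same commutator
       pairing. *)
    have wC h k : H h -> K k -> w h k - w k h = b h k - b' h k.
      move=> Hh Kk; rewrite bE // bE' //.
      have [c [_ ec]] := ff'; have [c' [_ ec']] := gg'.
      have e1 := ec h k I I; have e2 := ec k h I I.
      have e3 := ec' h k I I; have e4 := ec' k h I I.
      rewrite (cHK Hh Kk) in e1 e3; rewrite /w.
      by apply: (eq_lc (eqB (eqB e2 e1) (eqB e4 e3))); zmod.
    have cobE := restriction_coboundary mw.
    split=> [/fgw/cobE[[chi t1 t2] sym]|[[chi [t1 t2]] bb']].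
      split; first by exists chi.
      move=> h k Hh Kk /=; apply: subr0_eq.
      by rewrite -wC // sym // subrr.
    apply/fgw/cobE; split; first by exists chi.
    move=> h k Hh Kk; apply: subr0_eq.
    by rewrite wC //; have /= -> := bb' h k Hh Kk; rewrite subrr.
Qed.

End UpperBound.

End CentralProduct.

Theorem theoremB (G : groupType) (H K : G -> Prop) (D : zmodType) :
  central_product H K -> divisible D ->
  let A := setI_g H K in
  let Z := setI_g (derived H) (derived K) in
  let L := akernel (H2Q D H A) (H2Q D H Z) (@infl G D) in
  let M := akernel (H2Q D K A) (H2Q D K Z) (@infl G D) in
  let S := asum (aquot (H2Q D H A) L) (aquot (H2Q D K A) M) in
  let S' := asum (H2Q D H Z) (H2Q D K Z) in
  let H2G := H2Q D (@setT_g G) (@set1_g G) in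
  [/\ aiso (asub (H2Q D H A) L) (HomQ D (setI_g A (derived H)) Z),
      aiso (asub (H2Q D K A) M) (HomQ D (setI_g A (derived K)) Z),
      (exists N : ac S -> Prop,
         [/\ is_asubgroup S N,
             aiso (asub S N) (HomQ D Z (@set1_g G)) &
             aembeds (asum (aquot S N) (HomTensorQ D H A K A)) H2G]) &
      (exists N' : ac S' -> Prop,
         [/\ is_asubgroup S' N',
             aiso (asub S' N') (HomQ D Z (@set1_g G)) &
             aembeds H2G
               (asum (aquot S' N')
                     (HomTensorQ D H (@set1_g G) K (@set1_g G)))])].
Proof.
move=> HK divD; have [[sH _] [[sK _] [_ cHK]]] := HK.
have sA : is_subgroup (setI_g H K) by exact: subgroupI.
have sZ : is_subgroup (setI_g (derived H) (derived K)).
  by apply: subgroupI; apply: derived_subgroup.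
have ZA x : setI_g (derived H) (derived K) x -> setI_g H K x.
  by move=> [dHx dKx]; split; apply: derived_sub.
split.
- apply: ker_infl_iso => //; first by move=> x [].
    by move=> a h [_ Ka] Hh; apply/esym/cHK.
  by move=> x [].
- apply: ker_infl_iso => //; first by move=> x [].
    by move=> a k [Ha _] Kk; apply: cHK.
  by move=> x [].
- exact: H2_central_product_lower.
- exact: H2_central_product_upper.
Qed.
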